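(* There exists an absolute constant $K$ such that the following holds. Let $D_{ARV}\ge 1$ be a given parameter and $T=\lceil \log_2 D_{ARV}\rceil$. For every $\beta>1$, every $D_n>\sqrt{\log n}$ and every $d\ge D_{ARV}D_n\log_2^2 n$, and for all graphs $G=(V_G,E_G)$ and $H=(V_H,E_H)$ on vertex sets $V_G=L_G\cup R_G$, $V_H=L_H\cup R_H$ with $|L_G|=|R_G|=|L_H|=|R_H|=n/2$ and $|E_H|\le dn/2$, with probability at least $1-1/n^2$ over $\pi$ chosen uniformly at random from $\Pi_{LR}$ the following holds: for every feasible SDP solution $\varphi:V_G\to\mathbb R^n$ and every $\eta=2^{-t}$ with integer $0\le t\le T$, the set $\mathcal S$ has at most $K\eta dn$ elements, where $\mathcal S$ is the set of ordered pairs $(u,v)\in V_G\times V_G$ such that (1) $(u,v)\in\pi(E_H)$ and $\|\varphi(u)-\varphi(v)\|^2\le \delta/2$; (2) $M_{\beta d}(\mathrm{Ball}_\varphi(v,2\delta))\le \eta\beta d n$; (3) $\mathrm{short}_{\varphi,\delta/2}(u,G)\ge \max\{\beta d,\ \deg(u,H)/D_n\}$.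
   Context: $\delta=1/12$. $\Pi_{LR}$ is the set of bijections $\pi:V_H\to V_G$ with $\pi(L_H)=L_G$, $\pi(R_H)=R_G$; $\pi(E_H)=\{(\pi(x),\pi(y)):(x,y)\in E_H\}$. $F=G\boxplus_\pi H$ is the graph on $V_G$ with edge set $E_G\cup\pi(E_H)$, and $N_F(w)$ is the neighborhood of $w$ in $F$. A feasible SDP solution is a map $\varphi:V_G\to\mathbb R^n$ with $\|\varphi(u)\|^2=1/2$ for all $u$, $\sum_{v\in V_G}(1-\|\varphi(u)-\varphi(v)\|^2)\le n/2$ for all $u$, and $\|\varphi(u)-\varphi(v)\|^2+\|\varphi(v)-\varphi(w)\|^2\ge\|\varphi(u)-\varphi(w)\|^2$ for all $u,v,w$. $\mathrm{Ball}_\varphi(v,r)=\{w\in V_G:\|\varphi(v)-\varphi(w)\|^2\le r\}$. For $B\subseteq V_G$, $M_\xi(B)=\sum_{w\in V_G}\min\{|N_F(w)\cap B|,\xi\}$. $\mathrm{short}_{\varphi,\delta/2}(u,G)$ is the number of edges $(u,w)\in E_G$ with $\|\varphi(u)-\varphi(w)\|^2\le\delta/2$. For $u\in V_G$, $\deg(u,H)$ denotes the degree of $\pi^{-1}(u)$ in $H$. $G$ is not assumed to have no edges between $L_G$ and $R_G$. *)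

(* Defs.v *)
From HB Require Import structures.
From Stdlib Require Import Reals.
From mathcomp Require Import all_boot all_order all_algebra.
From mathcomp Require Import boolp Rstruct.
Set Implicit Arguments. Unset Strict Implicit. Unset Printing Implicit Defensive.
Import Order.TTheory GRing.Theory Num.Theory.
Local Open Scope ring_scope.

Definition R := Rdefinitions.R.

Definition delta : R := 1 / 12%:R.

Definition log2 (x : R) : R := Rpower.ln x / Rpower.ln 2.

Definition sqnorm (n : nat) (x : 'I_n -> R) : R := \sum_(i < n) x i ^+ 2.
Definition sqd (n : nat) (x y : 'I_n -> R) : R := \sum_(i < n) (x i - y i) ^+ 2.

Definition is_graph (V : finType) (e : rel V) : Prop := symmetric e /\ irreflexive e.

Definition nedges (V : finType) (e : rel V) : R :=
  (#|[set p : V * V | e p.1 p.2]|)%:R / 2%:R.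

Definition PiLR (VH VG : finType) (LH RH : {set VH}) (LG RG : {set VG})
  : {set {ffun VH -> VG}} :=
  [set f : {ffun VH -> VG} | [&& injectiveb f, f @: [set: VH] == [set: VG],
                                 f @: LH == LG & f @: RH == RG]].

Definition in_piE (VH VG : finType) (eH : rel VH) (pi : {ffun VH -> VG}) (u v : VG) : bool :=
  [exists x : VH, exists y : VH, [&& eH x y, pi x == u & pi y == v]].

Definition eF (VH VG : finType) (eG : rel VG) (eH : rel VH) (pi : {ffun VH -> VG}) : rel VG :=
  fun u w => eG u w || in_piE eH pi u w.

Definition NF (VH VG : finType) (eG : rel VG) (eH : rel VH) (pi : {ffun VH -> VG}) (w : VG)
  : {set VG} := [set x | eF eG eH pi w x].

Definition Mxi (VH VG : finType) (eG : rel VG) (eH : rel VH) (pi : {ffun VH -> VG})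
  (xi : R) (B : {set VG}) : R :=
  \sum_(w : VG) Num.min (#|NF eG eH pi w :&: B|)%:R xi.

Definition feasible_sdp (VG : finType) (n : nat) (phi : VG -> 'I_n -> R) : Prop :=
  (forall u, sqnorm (phi u) = 1 / 2%:R) /\
  (forall u, \sum_(v : VG) (1 - sqd (phi u) (phi v)) <= n%:R / 2%:R) /\
  (forall u v w, sqd (phi u) (phi w) <= sqd (phi u) (phi v) + sqd (phi v) (phi w)).

Definition Ball (VG : finType) (n : nat) (phi : VG -> 'I_n -> R) (v : VG) (r : R) : {set VG} :=
  [set w | sqd (phi v) (phi w) <= r].

Definition short (VG : finType) (n : nat) (phi : VG -> 'I_n -> R) (r : R) (u : VG) (eG : rel VG)
  : nat := #|[set w | eG u w && (sqd (phi u) (phi w) <= r)]|.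

Definition degH (VH VG : finType) (eH : rel VH) (pi : {ffun VH -> VG}) (u : VG) : nat :=
  #|[set y : VH | [exists x : VH, (pi x == u) && eH x y]]|.

Definition Sset (VH VG : finType) (n : nat) (eG : rel VG) (eH : rel VH) (pi : {ffun VH -> VG})
  (phi : VG -> 'I_n -> R) (beta d Dn eta : R) : {set VG * VG} :=
  [set p : VG * VG |
    [&& in_piE eH pi p.1 p.2,
        sqd (phi p.1) (phi p.2) <= delta / 2%:R,
        Mxi eG eH pi (beta * d) (Ball phi p.2 (2%:R * delta)) <= eta * beta * d * n%:R &
        Num.max (beta * d) ((degH eH pi p.1)%:R / Dn) <= (short phi (delta / 2%:R) p.1 eG)%:R]].

Definition prob_unif (T : finType) (A : {set T}) (P : T -> Prop) : R :=
  (#|[set x in A | `[< P x >]]|)%:R / (#|A|)%:R.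

(* Main.v *)
(* Union bound over a short description of the SDP solution.

   If (u,v) is in S, then all short G-neighbours of u lie in Ball(v,delta), and
   (2) together with (3) says that few vertices have many G-neighbours in
   Ball(v,2delta).  Take the vertices x of H whose degree is about D, so that
   images of x in S have at least s = max(beta d, D/(4 Dn)) short G-neighbours,
   and sample about 4n/s random points of V_G.  For at least half of the pairs
   (u,v) of S the sample meets the short neighbourhood of u, while only
   O(eta n) vertices u' have a sampled G-neighbour near v; the truncation at
   beta d in M is exactly what bounds the expected number of such u'.
   Nearness to v is decoded from a sketch of O(log n) bits per vertex
   (quantised random projections).  Hence, once the sample and the sketches of
   its points are fixed, every v has only polynomially many candidate sets A,
   each of size O(eta n), and half of S is counted by
   Z = sum_v max_A |N_{pi(H)}(v) cap A|.

   For fixed data, the tail of Z is bounded by revealing pi one vertex x at a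
   time: a single x influences at most D of the summands, and the potential
   prod_v (sum_A e^{|N(v) cap A|})^{1/D} grows by at most e^{O(eta deg(x)/D)}
   on average, because its exponents sum to at most 1 over the affected v.
   So P(Z > K eta (E + dn/log n)) <= exp(-K' eta dn / (D log n)), where E is the
   number of edges at the class; this beats the number n^{O(n/s)} of data. *)
Require Import Defs.
From HB Require Import structures.
From Stdlib Require Import Reals.
From mathcomp Require Import all_boot all_order all_algebra.
From mathcomp Require Import perm boolp Rstruct.
From mathcomp Require Import zify ring lra.
Set Implicit Arguments. Unset Strict Implicit. Unset Printing Implicit Defensive.
Import Order.TTheory GRing.Theory Num.Theory.
Local Open Scope ring_scope.

(** * Uniform averages and Rademacher projections *)

Definition avg (F : realFieldType) (T : finType) (f : T -> F) : F :=
  (\sum_t f t) / #|T|%:R.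

Section Avg.
Variables (F : realFieldType) (T : finType).
Implicit Types (f g : T -> F) (p : pred T).

Lemma eq_avg f g : f =1 g -> avg f = avg g.
Proof. by move=> e; rewrite /avg (eq_bigr _ (fun t _ => e t)). Qed.

Lemma avgD f g : avg (fun t => f t + g t) = avg f + avg g.
Proof. by rewrite /avg big_split /= mulrDl. Qed.

Lemma avgZ (c : F) f : avg (fun t => c * f t) = c * avg f.
Proof. by rewrite /avg -mulr_sumr mulrA. Qed.

Lemma avg_sum (I : finType) (P : pred I) (f : I -> T -> F) :
  avg (fun t => \sum_(i | P i) f i t) = \sum_(i | P i) avg (f i).
Proof. by rewrite /avg exchange_big /= -mulr_suml. Qed.

Lemma le_avg f g : (forall t, f t <= g t) -> avg f <= avg g.
Proof. by move=> h; rewrite ler_wpM2r ?invr_ge0// ler_sum. Qed.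

Lemma avg_ge0 f : (forall t, 0 <= f t) -> 0 <= avg f.
Proof. by move=> h; rewrite divr_ge0// sumr_ge0. Qed.

Lemma avg_cst (c : F) : (0 < #|T|)%N -> avg (fun _ : T => c) = c.
Proof.
move=> T0; rewrite /avg sumr_const -[c *+ _]mulr_natr mulfK//.
by rewrite pnatr_eq0 -lt0n.
Qed.

Lemma avg_inj (s : T -> T) f : injective s -> avg (fun t => f (s t)) = avg f.
Proof. by move=> s_inj; rewrite /avg [in RHS](reindex_inj s_inj). Qed.

Lemma exists_ge_avg f : (0 < #|T|)%N -> exists t, avg f <= f t.
Proof.
move=> T0; apply/existsP; apply: contraT; rewrite negb_exists => /forallP h.
suff: \sum_t f t < \sum_(t : T) avg f.
  by rewrite sumr_const -[avg f *+ _]mulr_natr divfK ?ltxx// pnatr_eq0 -lt0n.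
apply: ltr_sum => [|t _]; last by rewrite ltNge h.
by have /card_gt0P[t _] := T0; apply/hasP; exists t; rewrite ?mem_index_enum.
Qed.

Lemma exists_of_avg_lt1 p :
  (0 < #|T|)%N -> avg (fun t => (p t)%:R) < 1 :> F -> exists t, ~~ p t.
Proof.
move=> T0 h; apply/existsP; apply: contraT; rewrite negb_exists => /forallP h'.
move: h; rewrite (eq_avg (g := fun=> 1)) ?avg_cst ?ltxx// => t.
by move: (h' t); case: (p t).
Qed.

End Avg.

Lemma avg_prod (F : realFieldType) (I T : finType) (f : I -> T -> F) :
  avg (fun w : {ffun I -> T} => \prod_i f i (w i)) = \prod_i avg (f i).
Proof.
rewrite /avg big_split/= bigA_distr_bigA/= prodr_const card_ffun.
by rewrite natrX exprVn.
Qed.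

(** * Second and fourth moments of sums with independent random signs *)

Section Rademacher.
Variables (F : realFieldType) (J B : finType) (row : J -> B) (a : J -> F).
Implicit Types (w : {ffun J -> bool}) (s : seq J) (r : B).

Definition flip_sign j w : {ffun J -> bool} := [ffun k => (k == j) (+) w k].

Lemma flip_signK j : involutive (flip_sign j).
Proof. by move=> w; apply/ffunP=> k; rewrite !ffunE addbA addbb. Qed.

(** Flipping the sign at [j] permutes the sign vectors and negates the summand, so the average
    equals its own negative. *)
Lemma avg_sign_mul j (g : {ffun J -> bool} -> F) :
  (forall w, g (flip_sign j w) = g w) -> avg (fun w => (-1) ^+ w j * g w) = 0.
Proof.
move=> gj; set x := avg _.
suff : x = - x by move=> h; lra.
rewrite -mulN1r -avgZ -[x](avg_inj _ (inv_inj (flip_signK j))).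
by apply: eq_avg => w; rewrite gj ffunE eqxx signr_addb mulrA.
Qed.

(** Coordinates are grouped into rows, one signed sum per row. The list [s] holds the coordinates
    present so far, so that moments can be computed by adding one coordinate at a time. *)
Definition row_sum s w r := \sum_(j <- s | row j == r) (-1) ^+ w j * a j.
Definition row_energy s r := \sum_(j <- s | row j == r) a j ^+ 2.

Lemma row_sum_flip j s w r :
  j \notin s -> row_sum s (flip_sign j w) r = row_sum s w r.
Proof.
move=> js; rewrite /row_sum big_seq_cond [RHS]big_seq_cond.
apply: eq_bigr => k /andP[ks _]; rewrite ffunE.
by case: eqP ks js => [->->|].
Qed.

Lemma row_sum_cons j s w r : row_sum (j :: s) w r =
  (if row j == r then (-1) ^+ w j * a j else 0) + row_sum s w r.
Proof. by rewrite /row_sum big_cons; case: ifP => //; rewrite add0r. Qed.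

Lemma row_energy_cons j s r :
  row_energy (j :: s) r = (if row j == r then a j ^+ 2 else 0) + row_energy s r.
Proof. by rewrite /row_energy big_cons; case: ifP => //; rewrite add0r. Qed.

Lemma sqr_sign (b : bool) : (-1) ^+ b * (-1) ^+ b = 1 :> F.
Proof. by rewrite -signr_addb addbb. Qed.

Lemma avg_row_sum2 s r :
  uniq s -> avg (fun w => row_sum s w r ^+ 2) = row_energy s r.
Proof.
elim: s => [_|j s IH /= /andP[js us]].
  rewrite /row_energy big_nil (eq_avg (g := fun=> 0)) ?avg_cst// => [|w].
    by rewrite card_ffun card_bool expn_gt0.
  by rewrite /row_sum big_nil expr0n.
rewrite row_energy_cons -IH//.
rewrite (eq_avg (g := fun w => ((if row j == r then a j ^+ 2 else 0) +
   row_sum s w r ^+ 2) +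
   (-1) ^+ w j * (if row j == r then 2 * a j * row_sum s w r else 0))).
  rewrite avgD avg_sign_mul ?addr0.
    rewrite avgD avg_cst// card_ffun card_bool expn_gt0//.
  by move=> w; rewrite row_sum_flip.
move=> w; rewrite row_sum_cons; case: ifP => _; last by ring.
rewrite sqrrD exprMn [((-1) ^+ _) ^+ 2]sqr_sign; ring.
Qed.

Lemma avg_energy s :
  uniq s -> avg (fun w => \sum_r row_sum s w r ^+ 2) = \sum_r row_energy s r.
Proof. by move=> us; rewrite avg_sum; apply: eq_bigr => r _; rewrite avg_row_sum2. Qed.

Lemma sum_row_if j (x : F) (f : B -> F) :
  \sum_r (if row j == r then x * f r else 0) = x * f (row j).
Proof.
by rewrite -big_mkcond /= (big_pred1 (row j)) // => r; rewrite eq_sym.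
Qed.

(** Add one coordinate and expand: the part odd in the new sign averages to zero, and the new even
    cross term is controlled by the second moment of the row of [j]. The induction step loses only
    [2 * a j ^+ 4]. *)
Lemma avg_energy2_le s : uniq s ->
  avg (fun w => (\sum_r row_sum s w r ^+ 2) ^+ 2) <=
  (\sum_r row_energy s r) ^+ 2 + 2 * \sum_r row_energy s r ^+ 2.
Proof.
elim: s => [_|j s IH /= /andP[js us]].
  rewrite (eq_avg (g := fun=> 0)) ?avg_cst// => [||w].
  - by rewrite addr_ge0 ?sqr_ge0// mulr_ge0// sumr_ge0// => r _; rewrite sqr_ge0.
  - by rewrite card_ffun card_bool expn_gt0.
  - by rewrite big1 ?expr0n// => r _; rewrite /row_sum big_nil expr0n.
have eY w : \sum_r row_sum (j :: s) w r ^+ 2 =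
    (\sum_r row_sum s w r ^+ 2 + a j ^+ 2) +
    (-1) ^+ w j * (2 * a j * row_sum s w (row j)).
  rewrite -addrA.
  have -> : a j ^+ 2 + (-1) ^+ w j * (2 * a j * row_sum s w (row j)) =
     \sum_r (if row j == r then 1 * (a j ^+ 2 +
       (-1) ^+ w j * (2 * a j * row_sum s w r)) else 0).
    by rewrite sum_row_if mul1r.
  rewrite -big_split; apply: eq_bigr => r _ /=.
  rewrite row_sum_cons; case: ifP => _; last by ring.
  rewrite sqrrD exprMn [((-1) ^+ _) ^+ 2]sqr_sign; ring.
have eS : \sum_r row_energy (j :: s) r = \sum_r row_energy s r + a j ^+ 2.
  rewrite -[a j ^+ 2]mulr1 -(sum_row_if j (a j ^+ 2) (fun=> 1)) -big_split.
  by apply: eq_bigr => r _ /=; rewrite row_energy_cons mulr1 addrC.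
have eS2 : \sum_r row_energy (j :: s) r ^+ 2 =
    \sum_r row_energy s r ^+ 2 + 2 * a j ^+ 2 * row_energy s (row j) + a j ^+ 4.
  rewrite -addrA.
  have -> : 2 * a j ^+ 2 * row_energy s (row j) + a j ^+ 4 =
     \sum_r (if row j == r then 1 * (2 * a j ^+ 2 * row_energy s r + a j ^+ 4) else 0).
    by rewrite sum_row_if mul1r.
  rewrite -big_split; apply: eq_bigr => r _ /=.
  rewrite row_energy_cons; case: ifP => _; ring.
rewrite eS eS2.
rewrite (eq_avg (g := fun w => ((\sum_r row_sum s w r ^+ 2) ^+ 2 +
   2 * a j ^+ 2 * (\sum_r row_sum s w r ^+ 2) + a j ^+ 4 +
   4 * a j ^+ 2 * row_sum s w (row j) ^+ 2) +
   (-1) ^+ w j * (4 * a j * row_sum s w (row j) *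
     (\sum_r row_sum s w r ^+ 2 + a j ^+ 2)))).
  rewrite avgD avg_sign_mul ?addr0; last first.
    move=> w; rewrite row_sum_flip//; congr (_ * (_ + _)).
    by apply: eq_bigr => r _; rewrite row_sum_flip.
  rewrite !avgD !avgZ avg_cst ?card_ffun ?card_bool ?expn_gt0//.
  rewrite avg_energy// avg_row_sum2//.
  have := IH us; have : 0 <= a j ^+ 4 by rewrite (exprM _ 2 2) sqr_ge0.
  nra.
move=> w; rewrite eY sqrrD exprMn [((-1) ^+ _) ^+ 2]sqr_sign; ring.
Qed.

End Rademacher.

(** * Sketches of unit-scale vectors *)

Lemma ler_sqr_norm (F : realFieldType) (y x : F) : 0 <= y -> y <= `|x| -> y ^+ 2 <= x ^+ 2.
Proof. by move=> y0 yx; rewrite -(real_normK (num_real x)) lerXn2r ?nnegrE. Qed.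

Section Block.
Variables (b n : nat).
Hypothesis b_large : 16384%:R <= b%:R :> Defs.R.
Implicit Types (a c : 'I_n -> Defs.R) (w : {ffun 'I_b * 'I_n -> bool}) (r : 'I_b).

Definition mesh : Defs.R := 128%:R^-1.
Definition grid_size := Num.truncn (2%:R * b%:R / mesh).

(** Rounding is faithful only for [|x| < b], since [inord] sends an index off the grid to 0. The
    number of cells depends on [b] alone. *)
Definition grid_round (x : Defs.R) : 'I_grid_size.+1 :=
  inord (Num.truncn ((x + b%:R) / mesh)).
Definition grid_point (q : 'I_grid_size.+1) : Defs.R := q%:R * mesh - b%:R.

Lemma grid_roundK (x : Defs.R) : `|x| < b%:R -> `|grid_point (grid_round x) - x| <= mesh.
Proof.
rewrite ltr_norml => /andP[x1 x2].
have m0 : 0 < mesh by rewrite invr_gt0 ltr0n.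
set y := (x + b%:R) / mesh.
have y0 : 0 <= y by rewrite divr_ge0 ?(ltW m0)//; lra.
have yN : y <= 2%:R * b%:R / mesh by rewrite ler_wpM2r ?invr_ge0 ?(ltW m0)//; lra.
rewrite /grid_point inordK; last by rewrite ltnS le_truncn.
have xE : x = y * mesh - b%:R by rewrite /y divfK ?gt_eqF// addrK.
have /andP[t1 t2] := truncn_itv y0; rewrite -natr1 in t2.
rewrite -/y ler_norml; move: t1 t2; set t := (Num.truncn y)%:R => t1 t2.
have := ler_wpM2r (ltW m0) t1; have := ler_wpM2r (ltW m0) (ltW t2).
by move=> *; apply/andP; split; lra.
Qed.

Definition proj w r a := \sum_(i < n) (-1) ^+ w (r, i) * a i.

Lemma projB w r a c : proj w r (fun i => a i - c i) = proj w r a - proj w r c.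
Proof. by rewrite -sumrB; apply: eq_bigr => i _; rewrite mulrBr. Qed.

Lemma sum_row (f : 'I_b * 'I_n -> Defs.R) r :
  \sum_(j <- enum {: 'I_b * 'I_n} | j.1 == r) f j = \sum_i f (r, i).
Proof.
rewrite big_enum_cond /=.
rewrite (eq_bigl (fun j => (j.1 == r) && true)) => [|j]; last by rewrite andbT.
by rewrite (eq_bigr (fun j => f (j.1, j.2)))
  -?(pair_big (fun k => k == r) xpredT (fun k i => f (k, i))) ?big_pred1_eq// => -[].
Qed.

Lemma proj_row_sum w r a :
  proj w r a = row_sum fst (fun j => a j.2) (enum {: 'I_b * 'I_n}) w r.
Proof. by rewrite /row_sum sum_row. Qed.

Lemma row_energy_sqnorm r a :
  row_energy fst (fun j => a j.2) (enum {: 'I_b * 'I_n}) r = sqnorm a.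
Proof. by rewrite /row_energy sum_row. Qed.

Lemma avg_proj2 a : avg (fun w => \sum_r proj w r a ^+ 2) = b%:R * sqnorm a.
Proof.
under eq_avg do under eq_bigr do rewrite proj_row_sum.
rewrite avg_energy ?enum_uniq//; under eq_bigr do rewrite row_energy_sqnorm.
by rewrite sumr_const card_ord -[LHS]mulr_natl.
Qed.

Lemma proj2_variance a :
  avg (fun w => (\sum_r proj w r a ^+ 2 - b%:R * sqnorm a) ^+ 2) <=
  2 * b%:R * sqnorm a ^+ 2.
Proof.
rewrite (eq_avg (g := fun w => (\sum_r proj w r a ^+ 2) ^+ 2 +
  ((- 2 * b%:R * sqnorm a) * (\sum_r proj w r a ^+ 2) + (b%:R * sqnorm a) ^+ 2))).
  rewrite !avgD avgZ avg_proj2 avg_cst; last by rewrite card_ffun card_bool expn_gt0.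
  under eq_avg do under eq_bigr do rewrite proj_row_sum.
  have := avg_energy2_le fst (fun j => a j.2) (enum_uniq {: 'I_b * 'I_n}).
  under [X in _ <= X ^+ 2 + _]eq_bigr do rewrite row_energy_sqnorm.
  under [X in _ <= _ + 2 * X]eq_bigr do rewrite row_energy_sqnorm.
  by rewrite !sumr_const card_ord -[sqnorm a *+ b]mulr_natl -[_ ^+ 2 *+ b]mulr_natl; lra.
by move=> w; ring.
Qed.

Definition block := {ffun 'I_b -> 'I_grid_size.+1}.
Definition block_hash w a : block := [ffun r => grid_round (proj w r a)].
Definition block_close (t t' : block) :=
  \sum_r (grid_point (t r) - grid_point (t' r)) ^+ 2 <= b%:R * (3%:R / 2%:R * delta).

(** A gap test: distances between [delta] and [2 * delta] may be answered either way. *)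
Definition separates (cl : bool) a c :=
  ((sqd a c <= delta) ==> cl) && (cl ==> (sqd a c <= 2%:R * delta)).

Lemma sqdE a c : sqd a c = sqnorm (fun i => a i - c i).
Proof. by []. Qed.

(** The threshold [3/2 * delta] leaves room on both sides for the relative deviation 1/16 of the
    projected energy and for the rounding, which costs a factor 17/16 and an additive
    [b * delta / 16]. *)
Lemma block_close_separates w a c :
  (forall r, `|proj w r a| < b%:R) -> (forall r, `|proj w r c| < b%:R) ->
  `|\sum_r proj w r (fun i => a i - c i) ^+ 2 - b%:R * sqd a c| <
     b%:R * (Num.max (sqd a c) delta / 16%:R) ->
  separates (block_close (block_hash w a) (block_hash w c)) a c.
Proof.
move=> Ha Hc; rewrite ltr_norml => /andP[lo hi].
have m0 : 0 < mesh by rewrite invr_gt0 ltr0n.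
pose x r := proj w r (fun i => a i - c i).
pose y r := grid_point (block_hash w a r) - grid_point (block_hash w c r).
have xy r : `|y r - x r| <= 2 * mesh.
  rewrite /x projB /y !ffunE.
  have := grid_roundK (Ha r); have := grid_roundK (Hc r).
  by rewrite !ler_norml => /andP[? ?] /andP[? ?]; apply/andP; split; lra.
(* With [e = y - x], [2 x e <= x^2/16 + 16 e^2] gives [y^2 <= 17/16 x^2 + 17 e^2]; here
   [|e| <= 1/64], and [17/64^2 <= delta/16]. The converse bound is symmetric. *)
have [lem1 lem2] : \sum_r y r ^+ 2 <= 17%:R / 16%:R * (\sum_r x r ^+ 2) + b%:R * (delta / 16%:R) /\
   \sum_r x r ^+ 2 <= 17%:R / 16%:R * (\sum_r y r ^+ 2) + b%:R * (delta / 16%:R).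
  have -> : b%:R * (delta / 16%:R) = \sum_(r < b) (delta / 16%:R).
    by rewrite sumr_const card_ord -[RHS]mulr_natl.
  rewrite !mulr_sumr -!big_split; split; apply: ler_sum => r _ /=; rewrite /delta;
    have := xy r; rewrite ler_norml /mesh => /andP[e1 e2].
    have e2' : (y r - x r) ^+ 2 <= (2 * 128%:R^-1) ^+ 2 by nra.
    have := sqr_ge0 (x r / 4%:R - 4%:R * (y r - x r)); lra.
  have e2' : (y r - x r) ^+ 2 <= (2 * 128%:R^-1) ^+ 2 by nra.
  have := sqr_ge0 (y r / 4%:R + 4%:R * (y r - x r)); lra.
rewrite /separates /block_close -/(y _).
have -> : \sum_r (grid_point (block_hash w a r) - grid_point (block_hash w c r)) ^+ 2 =
  \sum_r y r ^+ 2 by [].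
have b0 : 0 < b%:R :> Defs.R by apply: lt_le_trans b_large; rewrite ltr0n.
move: lem1 lem2 lo hi; rewrite -/(x _).
have -> : \sum_r proj w r (fun i => a i - c i) ^+ 2 = \sum_r x r ^+ 2 by [].
set Y := \sum_r y r ^+ 2; set X := \sum_r x r ^+ 2; set D := sqd a c.
rewrite /delta => lem1 lem2 lo hi.
apply/andP; split; apply/implyP.
  move=> Dd; move: hi; rewrite (max_idPr Dd) => hi.
  have := ler_wpM2l (ltW b0) Dd; lra.
move=> cl; rewrite leNgt; apply/negP => Dd.
have Dd' : 1 / 12%:R <= D by lra.
move: lo; rewrite (max_idPl Dd') => lo.
have : b%:R * (2 * (1 / 12)) < b%:R * D by rewrite ltr_pM2l.
lra.
Qed.

(** A failure requires an overflowing projection of [a] or of [c], or a deviating energy. Markov's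
    inequality gives [1/(2b)] for each overflow and Chebyshev's gives [512/b] for the deviation. *)
Lemma avg_block_bad a c : sqnorm a = 1 / 2%:R -> sqnorm c = 1 / 2%:R ->
  avg (fun w => (~~ separates (block_close (block_hash w a) (block_hash w c)) a c)%:R)
    <= 1 / 16%:R :> Defs.R.
Proof.
move=> na nc.
have b0 : 0 < b%:R :> Defs.R by apply: lt_le_trans b_large; rewrite ltr0n.
set m := Num.max (sqd a c) delta.
have m0 : 0 < m by rewrite lt_max /delta divr_gt0 ?ltr0n ?orbT.
pose v := b%:R * (m / 16%:R).
have v0 : 0 < v by rewrite !mulr_gt0// invr_gt0 ltr0n.
have D0 : 0 <= sqd a c by apply: sumr_ge0 => i _; rewrite sqr_ge0.
apply: (@le_trans _ _ (avg (fun w => (b%:R ^- 2 * (\sum_r proj w r a ^+ 2) +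
  b%:R ^- 2 * (\sum_r proj w r c ^+ 2)) +
  v ^- 2 * (\sum_r proj w r (fun i => a i - c i) ^+ 2 - b%:R * sqd a c) ^+ 2))).
  have S0 w x : 0 <= b%:R ^- 2 * (\sum_r proj w r x ^+ 2).
    by rewrite mulr_ge0 ?sumr_ge0 ?invr_ge0 ?sqr_ge0// => r _; rewrite sqr_ge0.
  have big w x : ~ (forall r, `|proj w r x| < b%:R) ->
      1 <= b%:R ^- 2 * (\sum_r proj w r x ^+ 2).
    move=> /existsNP[r /negP]; rewrite -leNgt => xr.
    rewrite mulrC ler_pdivlMr ?exprn_gt0// mul1r (bigD1 r)//= -[X in X <= _]addr0.
    rewrite lerD ?sumr_ge0//; last by move=> k _; rewrite sqr_ge0.
    exact: ler_sqr_norm (ltW _) _.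
  apply: le_avg => w; case: (boolP (separates _ _ _)) => [_|/negP bad] /=.
    by rewrite !addr_ge0// mulr_ge0 ?invr_ge0 ?sqr_ge0.
  have V0 : 0 <= v ^- 2 * (\sum_r proj w r (fun i => a i - c i) ^+ 2 - b%:R * sqd a c) ^+ 2.
    by rewrite mulr_ge0 ?invr_ge0 ?sqr_ge0.
  have [Ha|/big Ha] := pselect (forall r, `|proj w r a| < b%:R); last first.
    by move: (S0 w c) V0 Ha; lra.
  have [Hc|/big Hc] := pselect (forall r, `|proj w r c| < b%:R); last first.
    by move: (S0 w a) V0 Hc; lra.
  have [lt|ge] := ltP `|\sum_r proj w r (fun i => a i - c i) ^+ 2 - b%:R * sqd a c| v.
    by case: bad; apply: block_close_separates.
  suff : 1 <= v ^- 2 * (\sum_r proj w r (fun i => a i - c i) ^+ 2 - b%:R * sqd a c) ^+ 2.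
    by move: (S0 w a) (S0 w c); lra.
  rewrite mulrC ler_pdivlMr ?exprn_gt0// mul1r.
  exact: ler_sqr_norm (ltW _) _.
rewrite !avgD !avgZ !avg_proj2 na nc.
have B1 : b%:R ^- 2 * (b%:R * (1 / 2%:R)) = b%:R^-1 / 2%:R :> Defs.R.
  by field; rewrite gt_eqF.
have B2 : v ^- 2 *
    avg (fun w => (\sum_r proj w r (fun i => a i - c i) ^+ 2 - b%:R * sqd a c) ^+ 2) <=
    512%:R * b%:R^-1.
  apply: (@le_trans _ _ (v ^- 2 * (2 * b%:R * m ^+ 2))).
    rewrite ler_wpM2l ?invr_ge0 ?sqr_ge0//; apply: le_trans (proj2_variance _) _.
    rewrite -sqdE; apply: ler_wpM2l; first by rewrite mulr_ge0 ?(ltW b0).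
    by rewrite lerXn2r ?nnegrE ?(ltW m0)// le_max lexx.
  have -> : v ^- 2 * (2 * b%:R * m ^+ 2) = 512%:R * b%:R^-1; last exact: lexx.
  by rewrite /v; field; rewrite !gt_eqF.
have : b%:R^-1 <= 16384%:R^-1 :> Defs.R by rewrite lef_pV2 ?posrE// ltr0n.
rewrite B1; move: B2; lra.
Qed.

End Block.

(** Exponential moments: when at least half of the [K] trials are bad, 16 to the number of bad
    trials is at least [4^K], while each factor [1 + 15 * p] has mean at most 2. *)
Lemma avg_majority_le (F : realFieldType) (T : finType) (p : pred T) (K : nat) :
  (0 < #|T|)%N -> avg (fun t => (p t)%:R) <= 1 / 16%:R :> F ->
  avg (fun w : {ffun 'I_K -> T} => (K <= 2 * #|[set j | p (w j)]|)%N%:R) <= 2 ^- K :> F.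
Proof.
move=> T0 hp.
apply: (@le_trans _ _ (avg (fun w : {ffun 'I_K -> T} =>
  4%:R ^- K * \prod_j (1 + 15%:R * (p (w j))%:R)))).
  apply: le_avg => w.
  have -> : \prod_j (1 + 15%:R * (p (w j))%:R) = 16%:R ^+ #|[set j | p (w j)]| :> F.
    rewrite -prodr_const [RHS]big_mkcond /=; apply: eq_bigr => j _.
    by rewrite inE; case: (p (w j)) => /=; rewrite ?mulr1 ?mulr0 ?addr0 -?natr1; ring.
  rewrite mulrC ler_pdivlMr ?exprn_gt0//; case: leqP => h; last by rewrite mul0r exprn_ge0.
  rewrite mul1r (_ : 16%:R = 4%:R ^+ 2); last by ring.
  by rewrite -exprM ler_eXn2l// ltr1n.
rewrite avgZ (avg_prod (fun _ t => 1 + 15%:R * (p t)%:R)) prodr_const card_ord.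
rewrite avgD avgZ avg_cst// mulrC ler_pdivrMr ?exprn_gt0//.
have -> : 2 ^- K * 4%:R ^+ K = 2 ^+ K :> F.
  by rewrite -exprVn -exprMn; congr (_ ^+ _); field.
have p0 : 0 <= avg (fun t => (p t)%:R) :> F by apply: avg_ge0 => t.
by apply: lerXn2r; rewrite ?nnegrE//; lra.
Qed.

Definition vote_close (T : finType) (cl : rel T) (K : nat) (t t' : {ffun 'I_K -> T}) :=
  (K < 2 * #|[set j | cl (t j) (t' j)]|)%N.

Lemma vote_separates (T : finType) (cl : rel T) (n K : nat) (t t' : {ffun 'I_K -> T})
    (a c : 'I_n -> Defs.R) :
  (2 * #|[set j | ~~ separates (cl (t j) (t' j)) a c]| < K)%N ->
  separates (vote_close cl t t') a c.
Proof.
set Bd := [set j | _]; rewrite /separates /vote_close; set C := [set j | _] => few.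
have := cardsC Bd; rewrite card_ord => cC.
apply/andP; split; apply/implyP=> h.
  suff /subset_leq_card : ~: Bd \subset C by lia.
  by apply/subsetP => j; rewrite !inE negbK /separates h => /andP[].
rewrite leNgt; apply/negP => far.
suff /subset_leq_card : C \subset Bd by lia.
apply/subsetP => j; rewrite !inE /separates => ->.
by move: far; rewrite ltNge => /negbTE ->; rewrite andbF.
Qed.

(** The alphabet [T] is fixed before [n]: blocks have constant width, and accuracy comes from a
    majority over [K] independent blocks. A pair fails with probability at most [2^-K] and there are
    fewer than [2^K] pairs, so a single choice of signs serves them all. *)
Lemma sketch_exists : exists (T : finType) (cl : rel T), (0 < #|T|)%N /\
  forall (n K : nat) (V : finType) (phi : V -> 'I_n -> Defs.R),
  (forall v, sqnorm (phi v) = 1 / 2%:R) -> (#|V| ^ 2 < 2 ^ K)%N ->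
  exists g : V -> {ffun 'I_K -> T},
    forall x v, separates (vote_close cl (g x) (g v)) (phi x) (phi v).
Proof.
(* The existential keeps the width abstract afterwards. *)
have [b b_large] : exists b : nat, 16384%:R <= b%:R :> Defs.R by exists 16384%N.
exists (block b), (@block_close b); split=> [|n K V phi phi1 VK].
  by rewrite card_ffun !card_ord expn_gt0.
pose Om : finType := {ffun 'I_b * 'I_n -> bool}.
have Om0 : (0 < #|{: Om}|)%N by rewrite card_ffun card_bool expn_gt0.
pose g (w : {ffun 'I_K -> Om}) v : {ffun 'I_K -> block b} :=
  [ffun j => block_hash (w j) (phi v)].
pose bad (w : {ffun 'I_K -> Om}) (p : V * V) :=
  (K <= 2 * #|[set j | ~~ separates (block_close (block_hash (w j) (phi p.1))
     (block_hash (w j) (phi p.2))) (phi p.1) (phi p.2)]|)%N.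
have [||w nbad] := @exists_of_avg_lt1 Defs.R {ffun 'I_K -> Om} (fun w => [exists p, bad w p]).
- by rewrite card_ffun expn_gt0 Om0.
- apply: (@le_lt_trans _ _ (\sum_p avg (fun w => (bad w p)%:R))).
    rewrite -avg_sum; apply: le_avg => w.
    case: existsP => [[p bp]|_]; last by rewrite sumr_ge0.
    by rewrite (bigD1 p)//= bp lerDl sumr_ge0.
  apply: (@le_lt_trans _ _ (\sum_(p : V * V) 2 ^- K)).
    apply: ler_sum => p _; apply: (@avg_majority_le _ Om (fun t => ~~ separates (block_close
      (block_hash t (phi p.1)) (block_hash t (phi p.2))) (phi p.1) (phi p.2))) => //.
    exact: avg_block_bad.
  rewrite sumr_const card_prod -[_ *+ _]mulr_natl ltr_pdivrMr ?exprn_gt0// mul1r.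
  by rewrite -natrX ltr_nat mulnn.
exists (g w) => x v; apply: vote_separates.
move: nbad; rewrite negb_exists => /forallP /(_ (x, v)); rewrite /bad /= -ltnNge.
by congr (_ * _ < _)%N; apply: eq_card => j; rewrite !inE !ffunE.
Qed.

(** * Sampling *)

Section Sampling.
Variables (F : realFieldType) (V : finType) (m : nat).
Hypothesis V0 : (0 < #|V|)%N.
Implicit Types (C : {set V}) (w : {ffun 'I_m -> V}).

Definition hit w C := [exists i, w i \in C].

Lemma avg_miss C :
  avg (fun w => (~~ hit w C)%:R) = (1 - #|C|%:R / #|V|%:R) ^+ m :> F.
Proof.
have n0 : #|V|%:R != 0 :> F by rewrite pnatr_eq0 -lt0n.
rewrite (eq_avg (g := fun w => \prod_i (w i \notin C)%:R)).
  rewrite (avg_prod (fun _ v => (v \notin C)%:R)) prodr_const card_ord /avg; congr (_ ^+ _).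
  have -> : \sum_t (t \notin C)%:R = #|~: C|%:R :> F.
    by rewrite -natr_sum -sum1_card [in RHS]big_mkcond; congr _%:R;
       apply: eq_bigr => v _; rewrite inE; case: (v \in C).
  by rewrite cardsCs setCK natrB ?max_card// mulrBl divff.
move=> w; rewrite /hit negb_exists; case: forallP => [h|/forallP].
  by rewrite big1// => i _; rewrite h.
by rewrite negb_forall => /existsP[i /negbNE wi]; rewrite (bigD1 i)//= wi mul0r.
Qed.

Lemma expr_onem_ge (p : F) : 0 <= p <= 1 -> 1 - m%:R * p <= (1 - p) ^+ m.
Proof.
move=> /andP[p0 p1]; elim: m => [|k IH]; first by rewrite mul0r subr0 expr0.
rewrite exprS -natr1; apply: le_trans (ler_wpM2l _ IH); last by lra.
have : 0 <= k%:R * (p * p) by rewrite !mulr_ge0.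
lra.
Qed.

(** A rational substitute for [(1 - p)^m <= exp (- m p)], sufficient for a constant miss
    probability. *)
Lemma expr_onem_le (p : F) : 0 <= p <= 1 -> (1 - p) ^+ m * (1 + m%:R * p) <= 1.
Proof.
move=> /andP[p0 p1]; elim: m => [|k IH]; first by rewrite mul0r addr0 expr0 mulr1.
apply: le_trans IH; rewrite exprSr -mulrA ler_wpM2l ?exprn_ge0 ?subr_ge0//.
rewrite -natr1; have : 0 <= k%:R * (p * p) by rewrite !mulr_ge0.
have := sqr_ge0 p; lra.
Qed.

Lemma density01 C : 0 <= (#|C|%:R / #|V|%:R : F) <= 1.
Proof.
by rewrite divr_ge0//= ler_pdivrMr ?ltr0n// mul1r ler_nat max_card.
Qed.

Lemma card_ffun_gt0 : (0 < #|{: {ffun 'I_m -> V}}|)%N.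
Proof. by rewrite card_ffun expn_gt0 V0. Qed.

Lemma avg_hit C :
  avg (fun w => (hit w C)%:R) = 1 - (1 - #|C|%:R / #|V|%:R) ^+ m :> F.
Proof.
rewrite -avg_miss; apply/eqP; rewrite eq_sym subr_eq -avgD; apply/eqP.
rewrite -[LHS](avg_cst _ card_ffun_gt0).
by apply: eq_avg => w; case: hit; rewrite ?addr0 ?add0r.
Qed.

(** If [#|C| <= xi], a union bound over the samples gives [m #|C| / #|V|], at most [4 #|C| / s], and
    [xi <= s]. If [#|C| > xi], the right side is 4. *)
Lemma avg_hit_le C (s xi : F) : 0 < xi -> xi <= s -> m%:R * s <= 4%:R * #|V|%:R ->
  avg (fun w => (hit w C)%:R) <= 4%:R / xi * Num.min #|C|%:R xi.
Proof.
move=> xi0 xis ms; have n0 : 0 < #|V|%:R :> F by rewrite ltr0n.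
rewrite avg_hit; have p01 := density01 C.
have [Cxi|xiC] := leP #|C|%:R xi.
  apply: (@le_trans _ _ (m%:R * (#|C|%:R / #|V|%:R))).
    by have := expr_onem_ge p01; lra.
  have h : m%:R / #|V|%:R <= 4%:R / xi.
    rewrite ler_pdivrMr// mulrAC ler_pdivlMr//; apply: le_trans ms.
    by rewrite ler_wpM2l.
  by rewrite mulrCA [leRHS]mulrC ler_wpM2l.
rewrite divfK ?gt_eqF//.
suff : 0 <= (1 - #|C|%:R / #|V|%:R) ^+ m :> F by set P := _ ^+ m => P0; lra.
by rewrite exprn_ge0// subr_ge0; case/andP: p01.
Qed.

Lemma avg_miss_le C (s : F) : s <= #|C|%:R -> 3%:R * #|V|%:R <= m%:R * s ->
  avg (fun w => (~~ hit w C)%:R) <= 1 / 4%:R :> F.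
Proof.
move=> sC ms; have n0 : 0 < #|V|%:R :> F by rewrite ltr0n.
rewrite avg_miss; have := expr_onem_le (density01 C).
have : 3%:R <= m%:R * (#|C|%:R / #|V|%:R) :> F.
  rewrite mulrA ler_pdivlMr//; apply: le_trans ms _.
  by rewrite ler_wpM2l.
have : 0 <= (1 - #|C|%:R / #|V|%:R) ^+ m :> F.
  by rewrite exprn_ge0// subr_ge0; case/andP: (density01 C).
set P := _ ^+ m; set x := m%:R * _ => P0 x3 Px.
have := ler_wpM2l P0 x3; lra.
Qed.

(** For each pair of [S] a miss has probability at most 1/4. The expected number of hit [u] is at
    most a quarter of the allowed [16 eta #|V|], so by Markov's inequality an excess also has
    probability at most 1/4. Each pair survives with probability at least 1/2, and some sample
    attains the average. *)
Lemma sample_pairs (N B : V -> {set V}) (S : {set V * V}) (s xi eta : F) :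
  0 < xi -> xi <= s -> 0 < eta ->
  3%:R * #|V|%:R <= m%:R * s -> m%:R * s <= 4%:R * #|V|%:R ->
  (forall p, p \in S -> s <= #|N p.1 :&: B p.2|%:R) ->
  (forall p, p \in S ->
     \sum_u Num.min #|N u :&: B p.2|%:R xi <= eta * xi * #|V|%:R) ->
  exists w, (#|S| <= 2 * #|[set p in S | hit w (N p.1 :&: B p.2) &&
     (#|[set u | hit w (N u :&: B p.2)]|%:R <= 16%:R * eta * #|V|%:R)%R]|)%N.
Proof.
move=> xi0 xis eta0 ms1 ms2 Ss Sxi; have n0 : 0 < #|V|%:R :> F by rewrite ltr0n.
pose L := 16%:R * eta * #|V|%:R.
have L0 : 0 < L by rewrite !mulr_gt0.
pose A w v := [set u | hit w (N u :&: B v)].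
pose good w (p : V * V) := hit w (N p.1 :&: B p.2) && (#|A w p.2|%:R <= L).
have [w hw] := exists_ge_avg (fun w => #|[set p in S | good w p]|%:R : F) card_ffun_gt0.
exists w; rewrite -(ler_nat F) natrM.
suff : #|S|%:R <= 2%:R * avg (fun w => #|[set p in S | good w p]|%:R : F).
  by move=> h; apply: le_trans h _; rewrite ler_wpM2l.
rewrite (eq_avg (g := fun w => \sum_(p in S) (good w p)%:R)); last first.
  move=> w'; rewrite -sum1_card natr_sum big_mkcond [RHS]big_mkcond /=.
  by apply: eq_bigr => p _; rewrite inE; case: (p \in S); case: (good w' p).
rewrite avg_sum -sum1_card natr_sum mulr_sumr; apply: ler_sum => p pS.
suff : avg (fun w => 1 - (good w p)%:R) <= 1 / 2%:R :> F.
  rewrite avgD avg_cst ?card_ffun_gt0//.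
  rewrite (eq_avg (f := fun w => - (good w p)%:R) (g := fun w => - 1 * (good w p)%:R)); last first.
    by move=> w'; rewrite mulN1r.
  rewrite avgZ; lra.
apply: (@le_trans _ _ (avg (fun w => (~~ hit w (N p.1 :&: B p.2))%:R +
   L^-1 * (\sum_u (hit w (N u :&: B p.2))%:R)))).
  apply: le_avg => w'; rewrite /good.
  have -> : \sum_u (hit w' (N u :&: B p.2))%:R = #|A w' p.2|%:R :> F.
    rewrite -sum1_card natr_sum [RHS]big_mkcond; apply: eq_bigr => u _.
    by rewrite inE; case: hit.
  case: hit => /=; last first.
    by rewrite subr0 lerDl mulr_ge0// invr_ge0 ltW.
  case: (leP #|A w' p.2|%:R L) => h /=; first by rewrite subrr add0r mulr_ge0// invr_ge0 ltW.
  by rewrite subr0 add0r mulrC ler_pdivlMr// mul1r ltW.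
rewrite avgD avgZ avg_sum.
have h1 := avg_miss_le (Ss p pS) ms1.
have h2 : \sum_u avg (fun w => (hit w (N u :&: B p.2))%:R) <= L / 4%:R.
  apply: (@le_trans _ _ (\sum_u (4%:R / xi * Num.min #|N u :&: B p.2|%:R xi))).
    by apply: ler_sum => u _; apply: avg_hit_le xi0 xis ms2.
  rewrite -mulr_sumr; apply: le_trans (ler_wpM2l _ (Sxi p pS)) _.
    by rewrite divr_ge0// ltW.
  rewrite le_eqVlt; apply/orP; left; apply/eqP; rewrite /L; field.
  by rewrite gt_eqF.
have : L^-1 * \sum_u avg (fun w => (hit w (N u :&: B p.2))%:R) <= 1 / 4%:R.
  by rewrite mulrC ler_pdivrMr//; lra.
lra.
Qed.

End Sampling.

(** * Revealing a random bijection *)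

(* Otherwise the arguments of [exp] and [ln] are parsed in [R_scope]. *)
Arguments exp x%_ring_scope.
Arguments ln x%_ring_scope.

Lemma exp_gt0 (x : Defs.R) : 0 < exp x.
Proof. exact/RltP/exp_pos. Qed.

Lemma exp_ge1D (x : Defs.R) : 1 + x <= exp x.
Proof. exact/RleP/exp_ineq1_le. Qed.

Lemma expD (x y : Defs.R) : exp (x + y) = exp x * exp y.
Proof. exact: exp_plus. Qed.

Lemma ler_exp (x y : Defs.R) : x <= y -> exp x <= exp y.
Proof.
rewrite le_eqVlt => /orP[/eqP-> //|/RltP xy].
exact/ltW/RltP/exp_increasing.
Qed.

Lemma exp_lnK (x : Defs.R) : 0 < x -> exp (ln x) = x.
Proof. by move=> /RltP; exact: exp_ln. Qed.

Lemma ln_le_sub1 (x : Defs.R) : 0 < x -> ln x <= x - 1.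
Proof. by move=> x0; have := exp_ge1D (ln x); rewrite exp_lnK//; lra. Qed.

Lemma lnM (x y : Defs.R) : 0 < x -> 0 < y -> ln (x * y) = ln x + ln y.
Proof. by move=> /RltP x0 /RltP y0; exact: ln_mult. Qed.

(* Tangent line of [ln] at the weighted arithmetic mean [M]. *)
Lemma exp_mean_ln_le (I : finType) (P : pred I) (rho : I -> Defs.R) (D : Defs.R) :
  0 < D -> #|P|%:R <= D -> (forall i, 0 <= rho i) ->
  exp (D^-1 * \sum_(i | P i) ln (1 + rho i)) <= 1 + D^-1 * \sum_(i | P i) rho i.
Proof.
move=> D0 PD rho0; set M := 1 + _.
have M1 : 1 <= M by rewrite lerDl mulr_ge0 ?invr_ge0 ?sumr_ge0// ltW.
have M0 : 0 < M by apply: lt_le_trans M1.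
rewrite -[leRHS]exp_lnK//; apply: ler_exp.
rewrite mulrC ler_pdivrMr//.
have lnM0 : 1 - M^-1 <= ln M.
  have : ln M^-1 <= M^-1 - 1 by apply: ln_le_sub1; rewrite invr_gt0.
  have : ln (M * M^-1) = 0 by rewrite divff ?gt_eqF//; exact: ln_1.
  by rewrite lnM ?invr_gt0//; lra.
apply: (@le_trans _ _ (\sum_(i | P i) (ln M + M^-1 * (1 + rho i) - 1))).
  apply: ler_sum => i _; have r1 : 0 < 1 + rho i by have := rho0 i; lra.
  have : ln (M^-1 * (1 + rho i)) <= M^-1 * (1 + rho i) - 1.
    by apply: ln_le_sub1; rewrite mulr_gt0// invr_gt0.
  have : ln (M * (M^-1 * (1 + rho i))) = ln (1 + rho i) by rewrite mulrA divff ?mul1r ?gt_eqF.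
  by rewrite lnM ?mulr_gt0 ?invr_gt0//; lra.
rewrite (eq_bigr (fun i => (ln M + M^-1 - 1) + M^-1 * rho i)) => [|i _]; last by ring.
rewrite big_split /= -mulr_sumr sumr_const.
have -> : \sum_(i | P i) rho i = D * (M - 1).
  by rewrite /M [1 + _]addrC addrK mulrA divff ?mul1r ?gt_eqF.
rewrite -[_ *+ #|P|]mulr_natr.
have h : (D - #|P|%:R) * (1 - M^-1) <= (D - #|P|%:R) * ln M by rewrite ler_wpM2l// subr_ge0.
have -> : M^-1 * (D * (M - 1)) = D * (1 - M^-1) by field; rewrite gt_eqF.
lra.
Qed.

Section Reveal.
Variables (VH VG T : finType) (Pi : {set {ffun VH -> VG}}) (X : {set VH}).
Implicit Types (pi : {ffun VH -> VG}) (P : {set VH}) (x y : VH) (u : VG) (tau : T).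

(* [P] is the part of [X] that has been revealed, and [H] depends only on it: even
   conditionally on the past, no value is taken with probability above [kappa]. *)
Definition spread (kappa : Defs.R) := forall P x u (H : {ffun VH -> VG} -> Defs.R),
  P \subset X -> x \in X -> x \notin P -> (forall pi, 0 <= H pi) ->
  (forall pi pi', {in P, pi =1 pi'} -> H pi = H pi') ->
  \sum_(pi in Pi | pi x == u) H pi <= kappa * \sum_(pi in Pi) H pi.

Variables (kappa q D : Defs.R) (e : rel VH) (a : T -> VG -> Defs.R).
Hypotheses (kappa_spread : spread kappa) (D0 : 0 < D) (T0 : (0 < #|T|)%N).
Hypotheses (a0 : forall tau u, 0 <= a tau u).
Hypothesis (aq : forall tau, kappa * \sum_u a tau u <= q).
Hypothesis (eD : {in X, forall x, #|[set y | e x y]|%:R <= D}).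

(** [pot] is a soft maximum over [tau] of the weights coming from the revealed vertices; [Psi] is
    the product of the [pot] over all [y], raised to the power [1/D]. *)
Definition wt P pi y tau := \prod_(x in P | e x y) (1 + a tau (pi x)).
Definition pot P pi y := \sum_tau wt P pi y tau.
Definition Psi P pi := exp (D^-1 * \sum_y ln (pot P pi y)).

Lemma wt_ge1 P pi y tau : 1 <= wt P pi y tau.
Proof.
apply: (big_ind (fun z => 1 <= z)) => // [z t z1 t1|x _].
  by rewrite -[1]mulr1 ler_pM.
by rewrite lerDl.
Qed.

Lemma wt_gt0 P pi y tau : 0 < wt P pi y tau.
Proof. exact: lt_le_trans (wt_ge1 P pi y tau). Qed.

Lemma pot_gt0 P pi y : 0 < pot P pi y.
Proof.
have /card_gt0P[tau _] := T0; rewrite /pot (bigD1 tau)//=.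
by apply: ltr_wpDr (wt_gt0 _ _ _ _); apply: sumr_ge0 => t _; exact/ltW/wt_gt0.
Qed.

Lemma eq_wt P pi pi' y tau : {in P, pi =1 pi'} -> wt P pi y tau = wt P pi' y tau.
Proof. by move=> h; apply: eq_bigr => x /andP[xP _]; rewrite h. Qed.

Lemma eq_pot P pi pi' y : {in P, pi =1 pi'} -> pot P pi y = pot P pi' y.
Proof. by move=> h; apply: eq_bigr => tau _; apply: eq_wt. Qed.

Lemma eq_Psi P pi pi' : {in P, pi =1 pi'} -> Psi P pi = Psi P pi'.
Proof. by move=> h; congr (exp (_ * _)); apply: eq_bigr => y _; rewrite (eq_pot _ h). Qed.

(* Conditionally on [pi] restricted to [P], [gain] has mean at most [q]. *)
Definition gain P x pi y := (\sum_tau wt P pi y tau * a tau (pi x)) / pot P pi y.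

Lemma gain_ge0 P x pi y : 0 <= gain P x pi y.
Proof.
apply: divr_ge0; last exact/ltW/pot_gt0.
by apply: sumr_ge0 => tau _; rewrite mulr_ge0// ltW// wt_gt0.
Qed.

Lemma potU1 P x pi y : x \notin P ->
  pot (x |: P) pi y = pot P pi y * (if e x y then 1 + gain P x pi y else 1).
Proof.
move=> xP; have wtU tau : wt (x |: P) pi y tau =
    wt P pi y tau * (if e x y then 1 + a tau (pi x) else 1).
  rewrite /wt big_mkcondr [in RHS]big_mkcondr (big_setU1 _ xP) /= mulrC.
  by case: (e x y).
rewrite /pot (eq_bigr _ (fun tau _ => wtU tau)); case: ifP => exy; last first.
  by rewrite mulr1; apply: eq_bigr => tau _; rewrite mulr1.
rewrite mulrDr mulr1 /gain mulrC divfK ?gt_eqF ?pot_gt0// -big_split /=.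
by apply: eq_bigr => tau _; rewrite mulrDr mulr1.
Qed.

(** Revealing [x] changes only the factors of its at most [D] neighbours, so the exponents [1/D] sum
    to at most 1 and concavity of [ln] bounds the product by an arithmetic mean. *)
Lemma PsiU1_le P x pi : x \in X -> x \notin P ->
  Psi (x |: P) pi <= Psi P pi * (1 + D^-1 * \sum_(y | e x y) gain P x pi y).
Proof.
move=> xX xP.
have -> : Psi (x |: P) pi =
    Psi P pi * exp (D^-1 * \sum_(y | e x y) ln (1 + gain P x pi y)).
  rewrite /Psi -expD -mulrDr; congr (exp (_ * _)).
  rewrite [X in _ + X]big_mkcond -big_split; apply: eq_bigr => y _ /=.
  rewrite potU1//; case: ifP => _; last by rewrite mulr1 addr0.
  by rewrite lnM ?pot_gt0// ltr_pwDl// gain_ge0.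
rewrite ler_wpM2l ?(ltW (exp_gt0 _))//; apply: exp_mean_ln_le => // [|y].
  by have := eD xX; rewrite cardsE.
exact: gain_ge0.
Qed.

(** The gain averages [a tau (pi x)] over [tau] with weights determined by the revealed part. For
    each [tau], weight times [Psi] is thus an admissible [H] in [spread]. *)
Lemma sum_gain_le P x y : P \subset X -> x \in X -> x \notin P ->
  \sum_(pi in Pi) Psi P pi * gain P x pi y <= q * \sum_(pi in Pi) Psi P pi.
Proof.
move=> PX xX xP.
pose H tau pi := Psi P pi / pot P pi y * wt P pi y tau.
have H0 tau pi : 0 <= H tau pi.
  by rewrite !mulr_ge0 ?invr_ge0 ?ltW ?exp_gt0 ?pot_gt0 ?wt_gt0.
have HP tau pi pi' : {in P, pi =1 pi'} -> H tau pi = H tau pi'.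
  by move=> h; rewrite /H (eq_Psi h) (eq_pot _ h) (eq_wt _ _ h).
have -> : \sum_(pi in Pi) Psi P pi * gain P x pi y =
    \sum_tau \sum_u a tau u * \sum_(pi in Pi | pi x == u) H tau pi.
  rewrite (eq_bigr (fun pi => \sum_tau H tau pi * a tau (pi x))); last first.
    move=> pi _; rewrite /gain mulrA mulrAC mulr_sumr.
    by apply: eq_bigr => tau _; rewrite /H mulrA.
  rewrite exchange_big; apply: eq_bigr => tau _ /=.
  rewrite (partition_big (fun pi => pi x) xpredT)//=; apply: eq_bigr => u _.
  by rewrite mulr_sumr; apply: eq_bigr => pi /andP[_ /eqP->]; rewrite mulrC.
have -> : \sum_(pi in Pi) Psi P pi = \sum_tau \sum_(pi in Pi) H tau pi.
  rewrite exchange_big; apply: eq_bigr => pi _ /=.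
  by rewrite -mulr_sumr -/(pot P pi y) divfK// gt_eqF// pot_gt0.
rewrite mulr_sumr; apply: ler_sum => tau _.
apply: (@le_trans _ _ (\sum_u a tau u * (kappa * \sum_(pi in Pi) H tau pi))).
  apply: ler_sum => u _; rewrite ler_wpM2l//.
  exact: (kappa_spread u PX xX xP (H0 tau) (HP tau)).
rewrite -mulr_suml mulrA ler_wpM2r ?sumr_ge0// mulrC; exact: aq.
Qed.

Lemma sum_PsiU1_le P x : P \subset X -> x \in X -> x \notin P ->
  \sum_(pi in Pi) Psi (x |: P) pi <=
    exp (D^-1 * (q * #|[set y | e x y]|%:R)) * \sum_(pi in Pi) Psi P pi.
Proof.
move=> PX xX xP.
apply: (@le_trans _ _ (\sum_(pi in Pi) (Psi P pi +
   D^-1 * \sum_(y | e x y) Psi P pi * gain P x pi y))).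
  apply: ler_sum => pi _; apply: le_trans (PsiU1_le _ xX xP) _.
  by rewrite mulrDr mulr1 lerD2l mulrCA mulr_sumr.
rewrite big_split /= -mulr_sumr exchange_big /=.
have S0 : 0 <= \sum_(pi in Pi) Psi P pi by apply: sumr_ge0 => pi _; exact/ltW/exp_gt0.
apply: le_trans (ler_wpM2r S0 (exp_ge1D _)).
rewrite mulrDl mul1r lerD2l -!mulrA ler_wpM2l ?invr_ge0 ?(ltW D0)//.
apply: (@le_trans _ _ (\sum_(y | e x y) q * \sum_(pi in Pi) Psi P pi)).
  by apply: ler_sum => y _; apply: sum_gain_le.
by rewrite sumr_const cardsE -[leLHS]mulr_natl mulrCA lexx.
Qed.

(** Induction over the revealed set, in any order. With nothing revealed each [pot] equals [#|T|],
    whence the term [#|VH| * ln #|T|]. *)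
Lemma sum_Psi_le P : P \subset X ->
  \sum_(pi in Pi) Psi P pi <= #|Pi|%:R *
    exp (D^-1 * (#|VH|%:R * ln #|T|%:R + q * \sum_(x in P) #|[set y | e x y]|%:R)).
Proof.
have [k] := ubnP #|P|; elim: k P => // k IH P Pk PX.
have [->|[x xP]] := set_0Vmem P.
  rewrite big_set0 mulr0 addr0 (eq_bigr (fun=> exp (D^-1 * (#|VH|%:R * ln #|T|%:R)))).
    by rewrite sumr_const -[_ *+ #|_|]mulr_natl.
  move=> pi _; congr (exp (_ * _)).
  rewrite (eq_bigr (fun=> ln #|T|%:R)); first by rewrite sumr_const -[_ *+ #|_|]mulr_natl.
  move=> y _; congr ln; rewrite /pot (eq_bigr (fun=> 1)) ?sumr_const// => tau _.
  by rewrite /wt big_pred0// => x; rewrite inE.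
have xP' : x \notin P :\ x by rewrite !inE eqxx.
have PX' : P :\ x \subset X by apply: subset_trans PX; apply: subD1set.
rewrite -{1}(setD1K xP); apply: le_trans (sum_PsiU1_le PX' (subsetP PX _ xP) xP') _.
apply: le_trans (ler_wpM2l (ltW (exp_gt0 _)) (IH _ _ PX')) _.
  by move: Pk; rewrite (cardsD1 x) xP.
rewrite mulrCA -expD le_eqVlt; apply/orP; left; apply/eqP; congr (_ * exp _).
by rewrite [in RHS](big_setD1 x)//=; ring.
Qed.

End Reveal.

(** Markov's inequality for [Psi] with all of [X] revealed. The choice of [s] needs no union bound,
    because [pot] already sums over every [tau]. *)
Lemma spread_concentration (VH VG T : finType) (Pi : {set {ffun VH -> VG}})
    (X : {set VH}) (kappa q D lam : Defs.R) (e : rel VH) (A : T -> {set VG}) :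
  spread Pi X kappa -> 0 < D -> (0 < #|T|)%N ->
  (forall tau, kappa * #|A tau|%:R <= q) ->
  {in X, forall x, #|[set y | e x y]|%:R <= D} ->
  #|[set pi in Pi | [exists s : {ffun VH -> T},
      lam <= \sum_y #|[set x in X | e x y && (pi x \in A (s y))]|%:R]]|%:R <=
  #|Pi|%:R * exp (D^-1 * (#|VH|%:R * ln #|T|%:R +
      2%:R * q * \sum_(x in X) #|[set y | e x y]|%:R - lam)).
Proof.
move=> sp D0 T0 Aq eD; set Bad := [set pi in Pi | _].
(* The weight 2 makes each counted edge contribute a factor [1 + 2 = 3 >= e]; it also turns [q] into
   [2 * q]. *)
pose a (tau : T) u : Defs.R := 2%:R * (u \in A tau)%:R.
have a0 tau u : 0 <= a tau u by rewrite mulr_ge0.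
have aq tau : kappa * \sum_u a tau u <= 2%:R * q.
  rewrite -mulr_sumr -natr_sum mulrCA ler_wpM2l//.
  suff -> : (\sum_u (u \in A tau) = #|A tau|)%N by [].
  by rewrite -sum1_card [RHS]big_mkcond; apply: eq_bigr => u _; case: (_ \in _).
have := sum_Psi_le sp D0 T0 a0 aq eD (subxx X).
set E := _ + _ => le.
have Bad_le pi : pi \in Bad -> exp (D^-1 * lam) <= Psi D e a X pi.
  rewrite inE => /andP[_ /existsP[s hs]]; apply: ler_exp.
  rewrite ler_wpM2l ?invr_ge0 ?(ltW D0)//; apply: le_trans hs _; apply: ler_sum => y _.
  set c := #|_|; have -> : c%:R = ln (exp c%:R) by rewrite ln_exp.
  suff le_pot : exp c%:R <= pot e a X pi y.
    move: le_pot; rewrite le_eqVlt => /orP[/eqP->//|/RltP lt].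
    by apply/ltW/RltP/ln_increasing => //; exact: exp_pos.
  apply: (@le_trans _ _ (wt e a X pi y (s y))); last first.
    rewrite /pot (bigD1 (s y))//= lerDl; apply: sumr_ge0 => t _.
    exact/ltW/wt_gt0.
  apply: (@le_trans _ _ (3%:R ^+ c)).
    rewrite -[c%:R]mulr_natl mulr1 -[c%:R]/(1 *+ c) -expRX lerXn2r ?nnegrE//.
      exact/ltW/exp_gt0.
    by apply/RleP; rewrite -INRE INR_IZR_INZ; exact: exp_le_3.
  rewrite /c -prodr_const big_mkcond /= /wt [leRHS]big_mkcond /=.
  apply: ler_prod => x _; rewrite inE; case: (x \in X) => /=; last by rewrite ler01 lexx.
  case: (e x y) => /=; last by rewrite ler01 lexx.
  by rewrite /a; case: (_ \in _) => /=; apply/andP; split; lra.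
have : #|Bad|%:R * exp (D^-1 * lam) <= \sum_(pi in Pi) Psi D e a X pi.
  rewrite mulr_natl -sumr_const.
  apply: le_trans (ler_sum _ Bad_le) _.
  rewrite [leRHS](big_setID Bad) /= -[leLHS]addr0; apply: lerD.
    by rewrite (setIidPr _)//; apply/subsetP => pi; rewrite inE => /andP[].
  by apply: sumr_ge0 => pi _; exact/ltW/exp_gt0.
move=> h; rewrite -(ler_pM2r (exp_gt0 (D^-1 * lam))); apply: le_trans h _.
apply: le_trans le _; rewrite -mulrA -expD -mulrDr.
by rewrite addrNK.
Qed.

(** * The bijections of [PiLR] *)

Section Bijections.
Variables (VH VG : finType).
Implicit Types (pi : {ffun VH -> VG}).

Lemma exists_bij_set (A : {set VH}) (B : {set VG}) (v0 : VG) : #|A| = #|B| ->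
  exists g : VH -> VG, {in A &, injective g} /\ g @: A = B.
Proof.
move=> AB; pose g x := nth v0 (enum B) (index x (enum A)).
have idx x : x \in A -> (index x (enum A) < size (enum B))%N.
  by move=> xA; rewrite -cardE -AB cardE index_mem mem_enum.
have g_inj : {in A &, injective g}.
  move=> x y xA yA /eqP; rewrite nth_uniq ?idx ?enum_uniq// => /eqP e.
  have [xs ys] : x \in enum A /\ y \in enum A by rewrite !mem_enum.
  exact: index_inj xs ys e.
exists g; split=> //; apply/eqP; rewrite eqEcard card_in_imset// AB leqnn andbT.
by apply/subsetP => _ /imsetP[x xA ->]; rewrite -mem_enum mem_nth// idx.
Qed.

Variables (LH RH : {set VH}) (LG RG : {set VG}).
Hypotheses (LRH : LH :|: RH = [set: VH]) (LRH0 : LH :&: RH = set0).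
Hypotheses (LRG : LG :|: RG = [set: VG]) (LRG0 : LG :&: RG = set0).

Let notL x : x \in RH -> x \notin LH.
Proof. by move=> xR; apply/negP => xL; have := in_set0 x; rewrite -LRH0 inE xL xR. Qed.

Let RE : RH = ~: LH.
Proof.
apply/setP => x; rewrite inE; apply/idP/idP => [/notL//|xL].
by have := in_setT x; rewrite -LRH inE (negPf xL).
Qed.

Lemma PiLR_neq0 : #|LH| = #|LG| -> #|RH| = #|RG| -> (0 < #|PiLR LH RH LG RG|)%N.
Proof.
move=> eL eR; have cHG : #|VH| = #|VG|.
  by rewrite -!cardsT -LRH -LRG !cardsU LRH0 LRG0 eL eR !cards0.
suff [f fP] : exists f, f \in PiLR LH RH LG RG by apply/card_gt0P; exists f.
case: (pickP (predT : pred VG)) => [v0 _|VG0]; last first.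
  have VG0' : #|VG| = 0%N by apply: eq_card0.
  have e0 (V : finType) (A : {set V}) : #|V| = 0%N -> A = set0.
    by move=> c; apply/eqP; rewrite -cards_eq0 -leqn0 -c max_card.
  exists (@ffun0 VH (fun=> VG) (etrans cHG VG0')); rewrite inE.
  rewrite [_ @: [set: VH]]e0// [_ @: LH]e0// [_ @: RH]e0//.
  rewrite [LG]e0// [RG]e0// [[set: VG]]e0// !eqxx !andbT.
  by apply/injectiveP => x y _; have := card0_eq (etrans cHG VG0') x; rewrite inE.
have [g1 [g1i g1L]] := exists_bij_set v0 eL.
have [g2 [g2i g2R]] := exists_bij_set v0 eR.
pose f := [ffun x => if x \in LH then g1 x else g2 x].
have fL : f @: LH = LG.
  by rewrite -g1L; apply: eq_in_imset => x xL; rewrite ffunE xL.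
have fR : f @: RH = RG.
  by rewrite -g2R; apply: eq_in_imset => x /notL xL; rewrite ffunE (negPf xL).
have fT : f @: [set: VH] = [set: VG] by rewrite -LRH imsetU fL fR.
exists f; rewrite inE fL fR fT !eqxx !andbT; apply/injectiveP => x y.
have /imset_injP : #|f @: [set: VH]| == #|[set: VH]| by rewrite fT !cardsT cHG.
by apply; rewrite inE.
Qed.

Definition swap_arg (x x' : VH) pi : {ffun VH -> VG} := [ffun z => pi (tperm x x' z)].

Lemma swap_argK x x' : involutive (swap_arg x x').
Proof. by move=> pi; apply/ffunP => z; rewrite !ffunE tpermK. Qed.

Lemma swap_arg_PiLR x x' pi : (x \in LH) = (x' \in LH) ->
  (swap_arg x x' pi \in PiLR LH RH LG RG) = (pi \in PiLR LH RH LG RG).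
Proof.
move=> xx'; wlog suff : pi / pi \in PiLR LH RH LG RG ->
    swap_arg x x' pi \in PiLR LH RH LG RG.
  by move=> h; apply/idP/idP => [/h|/h//]; rewrite swap_argK.
have img (A : {set VH}) : (x \in A) = (x' \in A) -> swap_arg x x' pi @: A = pi @: A.
  move=> xA; have tA z : (tperm x x' z \in A) = (z \in A).
    by case: tpermP => // ->.
  apply/setP => u; apply/imsetP/imsetP => -[z zA ->].
    by exists (tperm x x' z); rewrite ?tA// ffunE.
  by exists (tperm x x' z); rewrite ?tA// ffunE tpermK.
rewrite !inE => /and4P[/injectiveP pi_inj pT pL pR].
rewrite !img ?inE ?RE ?inE ?xx'// pT pL -RE pR !andbT.
by apply/injectiveP => y z; rewrite !ffunE => /pi_inj/perm_inj.
Qed.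

(* [pi x] can be exchanged with [pi x'] for each of the at least [N / 2] unrevealed
   vertices [x'] on the side of [x], which makes these values equidistributed. *)
Lemma PiLR_spread (N : nat) (X : {set VH}) : (0 < N)%N -> #|LH| = N -> #|RH| = N ->
  (2 * #|X :&: LH| <= N.+1)%N -> (2 * #|X :&: RH| <= N.+1)%N ->
  spread (PiLR LH RH LG RG) X (2%:R / N%:R).
Proof.
move=> N0 cL cR XL XR P x u H PX xX xP H0 HP.
set Pi := PiLR LH RH LG RG.
pose Sd := if x \in LH then LH else RH.
have Sdx : x \in Sd by rewrite /Sd RE; case: ifP => // /negbT; rewrite inE.
have SdP z : z \in Sd -> (x \in LH) = (z \in LH).
  by rewrite /Sd; case: ifP => [_ ->//|_ /notL/negPf->].
have [cS XS] : #|Sd| = N /\ (2 * #|X :&: Sd| <= N.+1)%N by rewrite /Sd; case: ifP.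
pose M := Sd :\: P.
have cM : (N <= 2 * #|M|)%N.
  have : (#|Sd :&: P| < #|X :&: Sd|)%N.
    apply: proper_card; apply/properP; split.
      by rewrite setIC setSI.
    by exists x; rewrite !inE ?xX ?Sdx// (negPf xP).
  by have := cardsID P Sd; rewrite -/M; lia.
set A := \sum_(pi in Pi | pi x == u) H pi.
have swapA x' : x' \in M -> A = \sum_(pi in Pi | pi x' == u) H pi.
  rewrite inE => /andP[x'P x'S].
  rewrite /A [in RHS](reindex_inj (inv_inj (swap_argK x x'))) /=.
  apply: eq_big => pi; first by rewrite swap_arg_PiLR ?(SdP _ x'S)// ffunE tpermR.
  move=> _; apply: HP => z zP; rewrite ffunE tpermD//.
    by apply: contraNneq xP => ->.
  by apply: contraNneq x'P => ->.
(* The events [pi x' = u] with [x'] in [M] are disjoint by injectivity, and all have the same weight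
   [A]. *)
have hM : #|M|%:R * A <= \sum_(pi in Pi) H pi.
  have -> : #|M|%:R * A = \sum_(x' in M) \sum_(pi in Pi | pi x' == u) H pi.
    by rewrite -(eq_bigr _ swapA) sumr_const -[RHS]mulr_natl.
  rewrite (exchange_big_dep (mem Pi)) /=; last by move=> ? ? _ /andP[].
  apply: ler_sum => pi piP.
  rewrite (eq_bigl (mem [set x' in M | pi x' == u])); last by move=> z /=; rewrite piP [in RHS]inE.
  rewrite sumr_const -[leLHS]mulr_natl -[leRHS]mul1r ler_wpM2r//.
  rewrite (_ : 1 = 1%:R)// ler_nat; apply/card_le1_eqP => y z.
  rewrite !inE => /andP[_ /eqP yu] /andP[_ /eqP zu].
  move: piP; rewrite inE => /andP[/injectiveP pi_inj _].
  by apply: pi_inj; rewrite yu zu.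
have A0 : 0 <= A by apply: sumr_ge0.
rewrite mulrAC ler_pdivlMr ?ltr0n//; apply: (@le_trans _ _ (2%:R * (#|M|%:R * A))).
  by rewrite mulrA mulrC ler_wpM2r// -natrM ler_nat.
by rewrite ler_wpM2l.
Qed.

(** [PiLR_spread] needs about half of each side to stay unrevealed, so [VH] is cut into a set and
    its complement, to be treated separately. [N.+1] allows for odd [N]. *)
Lemma exists_half_set (N : nat) : #|LH| = N -> #|RH| = N ->
  exists B : {set VH}, forall b : bool, let X := if b then B else ~: B in
    (2 * #|X :&: LH| <= N.+1)%N /\ (2 * #|X :&: RH| <= N.+1)%N.
Proof.
move=> cL cR.
have half (A : {set VH}) : #|A| = N -> exists B : {set VH}, B \subset A /\ #|B| = N./2.
  move=> cA; pose B := [set x in take N./2 (enum A)].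
  exists B; split; first by apply/subsetP => x; rewrite inE => /mem_take; rewrite mem_enum.
  rewrite cardsE (card_uniqP _) ?take_uniq ?enum_uniq// size_take -cardE cA.
  by case: ltnP => //; lia.
have [BL [BL1 BL2]] := half _ cL; have [BR [BR1 BR2]] := half _ cR.
have disj (A C : {set VH}) : A \subset LH -> C \subset RH -> A :&: C = set0.
  by move=> AL CR; apply/eqP; rewrite -subset0 -LRH0 setISS.
have EL : (BL :|: BR) :&: LH = BL.
  by rewrite setIUl (setIidPl BL1) [BR :&: _]setIC disj// setU0.
have ER : (BL :|: BR) :&: RH = BR.
  by rewrite setIUl (setIidPl BR1) disj// set0U.
have c2 (A B C : {set VH}) : B \subset A -> C :&: A = B -> #|A| = N -> #|B| = N./2 ->
    (2 * #|C :&: A| <= N.+1)%N /\ (2 * #|~: C :&: A| <= N.+1)%N.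
  move=> BA CA cA cB; rewrite CA; have := cardsID C A.
  by rewrite setIC CA setDE [A :&: _]setIC; lia.
exists (BL :|: BR) => b /=.
have [? ?] := c2 _ _ _ BL1 EL cL BL2; have [? ?] := c2 _ _ _ BR1 ER cR BR2.
by case: b.
Qed.

End Bijections.

(** * One degree class *)

Lemma card_bigcup_le (I T : finType) (P : pred I) (A : I -> {set T}) :
  (#|\bigcup_(i | P i) A i| <= \sum_(i | P i) #|A i|)%N.
Proof.
apply: (big_ind2 (fun (B : {set T}) k => #|B| <= k)%N) => [|B k C l Bk Cl|//].
  by rewrite cards0.
by apply: leq_trans (leq_card_setU B C) _; apply: leq_add.
Qed.

Lemma sqdC n (a c : 'I_n -> Defs.R) : sqd a c = sqd c a.
Proof. by apply: eq_bigr => i _; rewrite -sqrrN opprB. Qed.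

Definition outdeg (V : finType) (e : rel V) x := #|[set y | e x y]|.

Lemma degH_image (VH VG : finType) (eH : rel VH) (pi : {ffun VH -> VG}) x :
  injective pi -> degH eH pi (pi x) = outdeg eH x.
Proof.
move=> pi_inj; apply: eq_card => y; rewrite !inE.
apply/existsP/idP => [[z /andP[/eqP/pi_inj->]]//|exy].
by exists x; rewrite eqxx.
Qed.

Section DegreeClass.
Variables (VH VG T0 : finType) (eG : rel VG) (eH : rel VH) (n K : nat) (cl : rel T0).
Let T : finType := {ffun 'I_K -> T0}.
Hypothesis nVG : #|VG| = n.
Hypothesis n0 : (0 < n)%N.
Hypothesis sketch : forall phi : VG -> 'I_n -> Defs.R,
  (forall v, sqnorm (phi v) = 1 / 2%:R) ->
  exists g : VG -> T, forall x v, separates (vote_close cl (g x) (g v)) (phi x) (phi v).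
Variables (beta d Dn eta : Defs.R).
Let xi := beta * d.
Hypotheses (xi0 : 0 < xi) (eta0 : 0 < eta).
Implicit Types (pi : {ffun VH -> VG}) (phi : VG -> 'I_n -> Defs.R) (X : {set VH}).

Definition Sclass pi phi X : {set VG * VG} :=
  [set p in Sset eG eH pi phi beta d Dn eta | p.1 \in pi @: X].

(* The data [D] are the sampled vertices and their sketches; [tau] is the sketch of
   the vertex [v]. *)
Definition guess m (D : {ffun 'I_m -> VG * T}) (tau : T) : {set VG} :=
  [set u | [exists i, eG u (D i).1 && vote_close cl (D i).2 tau]].

(** Oversized guesses become empty, so the size bound holds for all data, including those arising
    from no solution. *)
Definition small_guess m (D : {ffun 'I_m -> VG * T}) tau : {set VG} :=
  if #|guess D tau|%:R <= 16%:R * eta * n%:R then guess D tau else set0.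

Lemma small_guess_card m (D : {ffun 'I_m -> VG * T}) tau :
  #|small_guess D tau|%:R <= 16%:R * eta * n%:R.
Proof. by rewrite /small_guess; case: ifP => // _; rewrite cards0 !mulr_ge0// ltW. Qed.

(** The decoded set [B v] lies between the balls of radius [delta] and [2 * delta] around [v]. By
    the inner ball, (3) gives it many neighbours of [u]; by the outer ball, (2) bounds its truncated
    sum. These are the hypotheses of [sample_pairs]. *)
Lemma Sclass_le_guess pi phi X (s : Defs.R) m :
  injective pi -> feasible_sdp phi -> xi <= s ->
  3%:R * n%:R <= m%:R * s -> m%:R * s <= 4%:R * n%:R ->
  {in X, forall x, s <= Num.max xi ((outdeg eH x)%:R / Dn)} ->
  exists (D : {ffun 'I_m -> VG * T}) (f : {ffun VH -> T}),
    (#|Sclass pi phi X| <=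
     2 * \sum_y #|[set x in X | eH x y && (pi x \in small_guess D (f y))]|)%N.
Proof.
move=> pi_inj [phi1 [_ tri]] xis ms1 ms2 sX.
have [g gP] := sketch phi1.
pose N u := [set w | eG u w]; pose B v := [set w | vote_close cl (g w) (g v)].
have B_in w v : sqd (phi w) (phi v) <= delta -> w \in B v.
  by move=> h; rewrite inE; have /andP[/implyP/(_ h)] := gP w v.
have B_out w v : w \in B v -> sqd (phi w) (phi v) <= 2%:R * delta.
  by rewrite inE => h; have /andP[_ /implyP/(_ h)] := gP w v.
have [|||p pS|p pS|w hw] := @sample_pairs _ VG m _ N B (Sclass pi phi X) s xi eta xi0 xis eta0.
- by rewrite nVG.
- by rewrite nVG.
- by rewrite nVG.
- move: pS; rewrite !inE => /andP[/and4P[_ h12 _ hshort] /imsetP[x xX px]].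
  apply: le_trans (sX x xX) _; rewrite -(degH_image _ _ pi_inj) -px.
  apply: le_trans hshort _; rewrite ler_nat; apply: subset_leq_card.
  apply/subsetP => z; rewrite !inE => /andP[-> hz] /=.
  (* A short neighbour of [u] is within [delta/2 + delta/2] of [v]. *)
  have := B_in z p.2; rewrite inE; apply.
  by apply: le_trans (tri z p.1 p.2) _; rewrite [sqd (phi z) _]sqdC; lra.
- move: pS; rewrite !inE => /andP[/and4P[_ _ hM _] _].
  rewrite nVG /xi mulrA; apply: le_trans hM; apply: ler_sum => u _.
  rewrite le_min !ge_min; apply/andP; split; apply/orP; [left|right; exact: lexx].
  rewrite ler_nat; apply: subset_leq_card; apply/subsetP => z.
  rewrite [z \in _ :&: _]inE => /andP[zN zB]; rewrite !inE /eF.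
  by move: zN; rewrite inE => -> /=; rewrite sqdC B_out.
pose D : {ffun 'I_m -> VG * T} := [ffun i => (w i, g (w i))].
have hit_guess u v : hit w (N u :&: B v) = (u \in guess D (g v)).
  by rewrite inE; apply: eq_existsb => i; rewrite !inE !ffunE.
exists D, [ffun y => g (pi y)]; apply: leq_trans hw _; rewrite leq_mul2l /=.
(* Surviving pairs are images of edges of [H]; counting these edges by [y] gives the required
   sum. *)
pose Q := [set q : VH * VH | (q.1 \in X) && eH q.1 q.2 &&
   (pi q.1 \in small_guess D (g (pi q.2)))].
apply: (@leq_trans #|[set (pi q.1, pi q.2) | q in Q]|).
  apply: subset_leq_card; apply/subsetP => -[u v].
  rewrite inE /= hit_guess => /andP[pS /andP[hu hA]].
  move: pS; rewrite inE => /andP[]; rewrite inE => /and4P[].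
  move=> /existsP[x /existsP[y /and3P[exy /eqP/= xu /eqP/= yv]]] _ _ _.
  rewrite /= -xu => /imsetP[x' x'X /pi_inj xx'].
  apply/imsetP; exists (x, y); rewrite ?yv ?xu// inE /= {1}xx' x'X exy /= yv xu.
  rewrite /small_guess ifT//; move: hA; rewrite nVG.
  by congr (_%:R <= _); apply: eq_card => z; rewrite [LHS]inE hit_guess.
apply: leq_trans (leq_imset_card _ _) _.
rewrite -sum1_card big_mkcond /= (eq_bigr (fun q => ((q.1, q.2) \in Q : nat))); last first.
  by move=> [x y] _; case: (_ \in Q).
rewrite -(pair_bigA _ (fun x y => ((x, y) \in Q : nat))) exchange_big /=.
apply: leq_sum => y _; rewrite -sum1_card [leqRHS]big_mkcond; apply: leq_sum => x _.
by rewrite !inE !ffunE -andbA; case: ifP => // ->.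
Qed.

Lemma card_guesses m : #|{: {ffun 'I_m -> VG * T}}| = ((n * #|T|) ^ m)%N.
Proof. by rewrite card_ffun card_prod nVG card_ord. Qed.

(** The union bound runs over the sampled data only. The sketches of the vertices [pi y] enter
    through [f], inside the event of [spread_concentration], and cost [n * ln #|T|] within the
    exponent. *)
Lemma Sclass_bad_le (Pi : {set {ffun VH -> VG}}) X (s lam D : Defs.R) m :
  {in Pi, forall pi, injective pi} -> (0 < #|T0|)%N -> #|VH| = n ->
  spread Pi X (4%:R / n%:R) -> 0 < D ->
  xi <= s -> 3%:R * n%:R <= m%:R * s -> m%:R * s <= 4%:R * n%:R ->
  {in X, forall x, (outdeg eH x)%:R <= D} ->
  {in X, forall x, s <= Num.max xi ((outdeg eH x)%:R / Dn)} ->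
  #|[set pi in Pi | `[< exists2 phi, feasible_sdp phi & 2%:R * lam < #|Sclass pi phi X|%:R >]]|%:R
   <= #|Pi|%:R * (((n * #|T|) ^ m)%N%:R * exp (D^-1 * (n%:R * ln #|T|%:R +
      128%:R * eta * \sum_(x in X) (outdeg eH x)%:R - lam))).
Proof.
move=> Pi_inj T00 nVH sp D0 xis ms1 ms2 XD sX.
pose Bad (G : {ffun 'I_m -> VG * T}) := [set pi in Pi | [exists f : {ffun VH -> T},
  lam <= \sum_y #|[set x in X | eH x y && (pi x \in small_guess G (f y))]|%:R]].
apply: (@le_trans _ _ (\sum_G #|Bad G|%:R)).
  rewrite -natr_sum ler_nat; apply: leq_trans (card_bigcup_le _ _).
  apply: subset_leq_card; apply/subsetP => pi; rewrite inE => /andP[piPi /asboolP[phi phiP big]].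
  have [G [f fP]] := Sclass_le_guess (Pi_inj _ piPi) phiP xis ms1 ms2 sX.
  apply/bigcupP; exists G => //; rewrite inE piPi; apply/existsP; exists f.
  move: fP; rewrite -(ler_nat Defs.R) natrM natr_sum => fP.
  have := lt_le_trans big fP; rewrite ltr_pM2l// => /ltW; exact: le_trans.
have T1 : (0 < #|{: T}|)%N by rewrite card_ffun expn_gt0 T00.
apply: (@le_trans _ _ (\sum_(G : {ffun 'I_m -> VG * T}) #|Pi|%:R * exp (D^-1 * (n%:R * ln #|T|%:R +
      128%:R * eta * \sum_(x in X) (outdeg eH x)%:R - lam)))).
  apply: ler_sum => G _.
  (* A guess of size at most [16 eta n] and [kappa = 4/n] give [q = 64 eta]. *)
  have -> : 128%:R * eta = 2%:R * (64%:R * eta) by ring.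
  have := @spread_concentration _ _ _ _ _ _ (64%:R * eta) _ lam _ (small_guess G) sp D0 T1 _ XD.
  rewrite nVH; apply=> tau.
  apply: (@le_trans _ _ (4%:R / n%:R * (16%:R * eta * n%:R))).
    by rewrite ler_wpM2l ?divr_ge0// small_guess_card.
  rewrite le_eqVlt; apply/orP; left; apply/eqP; field.
  by rewrite pnatr_eq0 -lt0n.
rewrite sumr_const card_guesses -[leLHS]mulr_natl mulrCA; exact: lexx.
Qed.

End DegreeClass.

(** * Logarithm estimates and the tail bound for one class *)

Lemma IZR2 : IZR 2 = 2%:R.
Proof. by rewrite -INRE INR_IZR_INZ. Qed.

Lemma ler_ln (x y : Defs.R) : 0 < x -> x <= y -> ln x <= ln y.
Proof.
move=> x0; rewrite le_eqVlt => /orP[/eqP->//|/RltP xy].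
by apply/ltW/RltP/ln_increasing => //; exact/RltP.
Qed.

Lemma lnXn (x : Defs.R) k : 0 < x -> ln (x ^+ k) = k%:R * ln x.
Proof.
move=> x0; elim: k => [|k IH]; first by rewrite expr0 mul0r; exact: ln_1.
by rewrite exprS lnM ?exprn_gt0// IH -natr1 mulrDl mul1r addrC.
Qed.

Lemma ln2_ge : 1 / 2%:R <= ln (2%:R : Defs.R).
Proof.
by have /RltP/ltW := ln_lt_2; rewrite -IZR2 mul1r.
Qed.

Lemma ln2_le1 : ln (2%:R : Defs.R) <= 1.
Proof. by apply: le_trans (ln_le_sub1 _) _; rewrite ?ltr0n//; lra. Qed.

Lemma log2E (x : Defs.R) : log2 x = ln x / ln 2%:R.
Proof. by rewrite /log2 IZR2. Qed.

Lemma expr2_lt_of_ceil_log2 (x : Defs.R) (t : nat) : 1 <= x ->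
  (t%:Z <= Num.ceil (log2 x))%R -> 2 ^+ t < 2%:R * x.
Proof.
move=> x1 tx; have x0 : 0 < x by lra.
have l0 : 0 < ln (2%:R : Defs.R) by have := ln2_ge; lra.
have : t%:R - 1 < log2 x.
  by have := ceilB1_lt (log2 x); rewrite -(ler_int Defs.R) in tx; rewrite intrB; lra.
rewrite log2E ltr_pdivlMr// => h.
rewrite -[ltLHS]exp_lnK ?exprn_gt0// -[ltRHS]exp_lnK ?mulr_gt0//.
apply/RltP/exp_increasing/RltP; rewrite lnXn ?ltr0n// lnM ?ltr0n//; lra.
Qed.

Lemma exists_log2_bound (n : nat) : (1 < n)%N -> exists L : nat,
  [/\ (n < 2 ^ L)%N, (0 < L)%N, (L.+1)%:R <= 2 * L%:R :> Defs.R,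
      L%:R <= 2 * log2 n%:R & 1 <= log2 n%:R].
Proof.
move=> n1; exists (trunc_log 2 n).+1.
have /andP[lo hi] := trunc_log_bounds (isT : (1 < 2)%N) (ltnW n1).
set k := trunc_log 2 n in lo hi *.
have l0 : 0 < ln (2%:R : Defs.R) by have := ln2_ge; lra.
have lg1 : 1 <= log2 n%:R.
  by rewrite log2E ler_pdivlMr// mul1r ler_ln ?ltr0n// ler_nat.
have lgk : k%:R <= log2 n%:R.
  rewrite log2E ler_pdivlMr// -lnXn ?ltr0n// ler_ln ?exprn_gt0 ?ltr0n//.
  by rewrite -natrX ler_nat.
split=> //; first by rewrite -[k.+2%:R]natr1 -[k.+1%:R]natr1; have : 0 <= k%:R :> Defs.R by []; lra.
by rewrite -natr1; lra.
Qed.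

(* [NT] sketch values, [m] sampled points: [(n * NT) ^ m] possible data. *)
Lemma union_bound_numeric (n L m NT : nat) (c0 Dn d D s eta E : Defs.R) :
  (0 < n)%N -> (n < 2 ^ L)%N -> (0 < L)%N -> (0 < NT)%N ->
  ln NT%:R = 2%:R * L%:R * c0 -> 0 <= c0 -> 1 / 2%:R <= Dn -> 0 < D -> D <= 2%:R * n%:R ->
  D / (4%:R * Dn) <= s -> m%:R * s <= 4%:R * n%:R -> 0 < eta -> 0 <= E ->
  Dn * L%:R ^+ 2 <= 8%:R * (eta * d) ->
  ((n * NT) ^ m)%N%:R * exp (D^-1 * (n%:R * ln NT%:R + 128%:R * eta * E -
     (512%:R + 288%:R * c0) * (eta * (E + d * n%:R / L%:R)))) <= exp (- (8%:R * L%:R)).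
Proof.
move=> n0 nL L0 NT0 lnT c00 Dn12 D0 Dn2 Ds ms eta0 E0 Dnd.
have nR : 0 < n%:R :> Defs.R by rewrite ltr0n.
have LR : 1 <= L%:R :> Defs.R by rewrite ler1n.
have LR0 : L%:R != 0 :> Defs.R by rewrite gt_eqF//; lra.
have nT0 : 0 < ((n * NT) ^ m)%N%:R :> Defs.R by rewrite ltr0n expn_gt0 muln_gt0 n0 NT0.
have lnn : ln n%:R <= L%:R :> Defs.R.
  apply: (@le_trans _ _ (ln (2%:R ^+ L))).
    by apply: ler_ln => //; rewrite -natrX ler_nat ltnW.
  by rewrite lnXn ?ltr0n// -[leRHS]mulr1 ler_wpM2l// ln2_le1.
rewrite -[X in X * _]exp_lnK// -expD; apply: ler_exp.
rewrite natrX lnXn ?ltr0n ?muln_gt0 ?n0// natrM lnM ?ltr0n// lnT.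
have mD : m%:R * D <= 16%:R * n%:R * Dn.
  have : m%:R * (D / (4%:R * Dn)) <= 4%:R * n%:R by apply: le_trans ms; rewrite ler_wpM2l.
  by rewrite mulrA ler_pdivrMr ?mulr_gt0//; lra.
have L1c : 0 <= L%:R * (1 + 2%:R * c0) by rewrite mulr_ge0//; lra.
have h1 : m%:R * D * (ln n%:R + 2%:R * L%:R * c0) <=
    16%:R * n%:R * Dn * (L%:R * (1 + 2%:R * c0)).
  apply: (@le_trans _ _ (m%:R * D * (L%:R * (1 + 2%:R * c0)))).
    by rewrite ler_wpM2l ?mulr_ge0// ?(ltW D0)//; lra.
  by rewrite ler_wpM2r.
(* Every cost is charged to [Q]: the number of data costs [(128 + 256 c0) Q], the initial potential
   [32 c0 Q], and the target [8 L D] at most [256 Q]. *)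
set Q := eta * d * n%:R / L%:R.
have hQ : Dn * L%:R * n%:R <= 8%:R * Q.
  rewrite /Q mulrA ler_pdivlMr; last by lra.
  have := ler_wpM2r (ltW nR) Dnd; lra.
have eQ : eta * (E + d * n%:R / L%:R) = eta * E + Q by rewrite /Q; ring.
have Q0 : 0 <= Q.
  have : 0 <= Dn * L%:R * n%:R by rewrite !mulr_ge0//; lra.
  lra.
have etaE : 0 <= eta * E by rewrite mulr_ge0// ltW.
have c0Q : c0 * (Dn * L%:R * n%:R) <= c0 * (8%:R * Q) by rewrite ler_wpM2l.
have c0E : 0 <= c0 * (eta * E) by rewrite mulr_ge0.
have nL0 : 0 <= n%:R * L%:R :> Defs.R by rewrite mulr_ge0.
have nLD : n%:R * L%:R <= 2%:R * (Dn * L%:R * n%:R) by have := ler_wpM2l nL0 Dn12; lra.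
have nLDc : c0 * (n%:R * L%:R) <= c0 * (2%:R * (Dn * L%:R * n%:R)) by rewrite ler_wpM2l.
have LD : 8%:R * L%:R * D <= 8%:R * L%:R * (2%:R * n%:R) by rewrite ler_wpM2l// mulr_ge0.
rewrite -(ler_pM2l D0) mulrDr [D * (D^-1 * _)]mulrA divff ?gt_eqF// mul1r eQ.
lra.
Qed.

(** Here the threshold [s] and the sample size [m] are fixed. If [X] is empty or [s > n], no pair
    can qualify; otherwise [Sclass_bad_le] and [union_bound_numeric] combine. *)
Lemma class_tail (VH VG T0 : finType) (cl : rel T0) (eG : rel VG) (eH : rel VH)
    (n L : nat) (beta d Dn eta D : Defs.R) (Pi : {set {ffun VH -> VG}}) (X : {set VH}) :
  let c0 := ln #|T0|%:R in
  (forall (n K : nat) (V : finType) (phi : V -> 'I_n -> Defs.R),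
    (forall v, sqnorm (phi v) = 1 / 2%:R) -> (#|V| ^ 2 < 2 ^ K)%N ->
    exists g : V -> {ffun 'I_K -> T0},
      forall x v, separates (vote_close cl (g x) (g v)) (phi x) (phi v)) ->
  (0 < #|T0|)%N -> #|VH| = n -> #|VG| = n -> (0 < n)%N -> (n < 2 ^ L)%N -> (0 < L)%N ->
  0 < d -> 1 < beta -> 1 / 2%:R <= Dn -> 0 < eta -> Dn * L%:R ^+ 2 <= 8%:R * (eta * d) ->
  {in Pi, forall pi : {ffun VH -> VG}, injective pi} -> spread Pi X (4%:R / n%:R) -> 0 < D ->
  (X != set0 -> D <= 2%:R * n%:R) ->
  {in X, forall x, (outdeg eH x)%:R <= D} ->
  {in X, forall x, D / (4%:R * Dn) <= Num.max (beta * d) ((outdeg eH x)%:R / Dn)} ->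
  #|[set pi in Pi | `[< exists2 phi : VG -> 'I_n -> Defs.R, feasible_sdp phi &
      2%:R * ((512%:R + 288%:R * c0) *
        (eta * (\sum_(x in X) (outdeg eH x)%:R + d * n%:R / L%:R)))
      < #|Sclass eG eH beta d Dn eta pi phi X|%:R >]]|%:R
   <= #|Pi|%:R * exp (- (8%:R * L%:R)).
Proof.
move=> c0 sk T00 nVH nVG n0 nL L0 d0 beta1 Dn12 eta0 Dnd Pi_inj sp D0 Dn2 XD XD'.
have c00 : 0 <= c0.
  have -> : 0 = ln 1 :> Defs.R by rewrite [RHS]ln_1.
  by apply: ler_ln; rewrite ?ltr01 ?ler1n.
set lam := (512%:R + _) * _.
set Bd := [set pi in Pi | _].
have LR : 0 < L%:R :> Defs.R by rewrite ltr0n.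
have nR : 0 < n%:R :> Defs.R by rewrite ltr0n.
have E0 : 0 <= \sum_(x in X) (outdeg eH x)%:R :> Defs.R by apply: sumr_ge0.
have lam0 : 0 <= lam.
  apply: mulr_ge0; first by lra.
  apply: mulr_ge0; first exact: ltW.
  by apply: addr_ge0 => //; rewrite divr_ge0 ?mulr_ge0 ?ltW.
have Bd0 : (forall pi, pi \in Pi -> forall phi : VG -> 'I_n -> Defs.R,
    Sclass eG eH beta d Dn eta pi phi X = set0) -> #|Bd|%:R <= #|Pi|%:R * exp (- (8%:R * L%:R)).
  move=> S0; have -> : Bd = set0.
    apply/setP => pi; rewrite !inE; apply/negP => /andP[/S0 S0' /asboolP[phi _]].
    by rewrite S0' cards0; lra.
  by rewrite cards0 mulr_ge0// ltW// exp_gt0.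
have [X0|Xn0] := eqVneq X set0.
  by apply: Bd0 => pi _ phi; apply/setP => p; rewrite [RHS]inE; apply/negP;
    rewrite inE X0 => /andP[_ /imsetP[x]]; rewrite inE.
have xi0 : 0 < beta * d by rewrite mulr_gt0//; lra.
pose s := Num.max (beta * d) (D / (4%:R * Dn)).
have xis : beta * d <= s by rewrite le_max lexx.
have Ds : D / (4%:R * Dn) <= s by rewrite le_max lexx orbT.
have s0 : 0 < s by apply: lt_le_trans xis.
have sX : {in X, forall x, s <= Num.max (beta * d) ((outdeg eH x)%:R / Dn)}.
  by move=> x xX; rewrite ge_max XD'// andbT le_max lexx.
have [sn|ns] := leP s n%:R; last first.
  apply: Bd0 => pi /Pi_inj pi_inj phi; apply/setP => p; rewrite [RHS]inE.
  apply/negP; rewrite !inE => /andP[/and4P[_ _ _ hshort] /imsetP[x xX px]].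
  move: hshort; rewrite px (degH_image _ _ pi_inj) => /(le_trans (sX x xX)).
  move=> /(lt_le_trans ns); rewrite ltr_nat ltnNge -{2}nVG; apply/negP/negPn.
  exact: max_card.
(* Rounding [3n/s] up adds at most [s <= n] to [m * s]. *)
pose m := (Num.truncn (3%:R * n%:R / s)).+1.
have [ms1 ms2] : 3%:R * n%:R <= m%:R * s /\ m%:R * s <= 4%:R * n%:R.
  have q0 : 0 <= 3%:R * n%:R / s by rewrite divr_ge0 ?mulr_ge0// ltW.
  have /andP[t1 t2] := truncn_itv q0.
  split; first by rewrite -ler_pdivrMr// ltW.
  rewrite /m -natr1 mulrDl mul1r; move: t1; rewrite ler_pdivlMr//; lra.
have nK : (#|VG| ^ 2 < 2 ^ (2 * L))%N by rewrite nVG mulnC expnM ltn_sqr.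
have sk' : forall phi : VG -> 'I_n -> Defs.R, (forall v, sqnorm (phi v) = 1 / 2%:R) ->
    exists g : VG -> {ffun 'I_(2 * L) -> T0},
      forall x v, separates (vote_close cl (g x) (g v)) (phi x) (phi v).
  by move=> phi phi1; apply: sk.
apply: le_trans (Sclass_bad_le eG nVG n0 sk' xi0 eta0 lam Pi_inj T00 nVH sp D0 xis ms1 ms2 XD sX) _.
rewrite ler_wpM2l//.
apply: union_bound_numeric Ds ms2 eta0 E0 Dnd => //.
- by rewrite card_ffun expn_gt0 T00.
- by rewrite card_ffun card_ord natrX lnXn ?ltr0n// natrM.
- exact: Dn2.
Qed.

(** * Union over classes and scales *)

Lemma prob_unif_ge (T : finType) (A : {set T}) (P : T -> Prop) (e : Defs.R) :
  (0 < #|A|)%N -> #|[set x in A | ~~ `[< P x >]]|%:R <= #|A|%:R * e ->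
  1 - e <= prob_unif A P.
Proof.
move=> A0 h; rewrite /prob_unif ler_pdivlMr ?ltr0n//.
have := cardsID [set x | `[< P x >]] A.
rewrite [A :&: _](_ : _ = [set x in A | `[< P x >]]); last by apply/setP => x; rewrite !inE.
rewrite [A :\: _](_ : _ = [set x in A | ~~ `[< P x >]]); last first.
  by apply/setP => x; rewrite !inE andbC.
move=> c; have {}c : #|A|%:R = #|[set x in A | `[< P x >]]|%:R +
   #|[set x in A | ~~ `[< P x >]]|%:R :> Defs.R by rewrite -natrD c.
by move: h; rewrite mulrBl mul1r; lra.
Qed.

(** Dyadic classes in units of [d]. Class 0 collects all small degrees, and class [L] suffices at
    the top because [2^(L+1) d >= 2^L]. *)
Lemma exists_degree_class (V : finType) (deg : V -> nat) (L : nat) (d : Defs.R) :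
  1 / 2%:R <= d -> (forall x, (deg x < 2 ^ L)%N) ->
  exists kc : V -> 'I_L.+1, forall x,
    (deg x)%:R < 2 ^+ (kc x).+1 * d /\ (kc x = 0%N :> nat \/ 2 ^+ kc x * d <= (deg x)%:R).
Proof.
move=> d12 degL; apply: (@fin_all_exists V (fun=> 'I_L.+1) (fun x k =>
  (deg x)%:R < 2 ^+ k.+1 * d /\ (k = 0%N :> nat \/ 2 ^+ k * d <= (deg x)%:R))) => x.
have base : (deg x)%:R < 2 ^+ L.+1 * d.
  apply: (@lt_le_trans _ _ (2 ^+ L : Defs.R)); first by rewrite -natrX ltr_nat.
  have : 0 < 2 ^+ L :> Defs.R by rewrite exprn_gt0.
  by rewrite exprS => L0; have := ler_wpM2l (ltW L0) d12; lra.
have exk : exists k, (deg x)%:R < 2 ^+ k.+1 * d by exists L.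
have [k kP kmin] := ex_minnP exk.
have kL : (k <= L)%N by exact: kmin base.
exists (Ordinal (kL : (k < L.+1)%N)); split=> //=.
case: k kP kmin kL => [|k] kP kmin kL; first by left.
by right; rewrite leNgt; apply/negP => /kmin; rewrite ltnn.
Qed.

Lemma sum_outdeg (V : finType) (e : rel V) :
  \sum_x (outdeg e x)%:R = 2%:R * nedges e :> Defs.R.
Proof.
rewrite /nedges mulrC divfK ?pnatr_eq0//.
rewrite -natr_sum; congr _%:R.
rewrite -sum1_card [RHS]big_mkcond /= [RHS](eq_bigr (fun q => (e q.1 q.2 : nat))); last first.
  by move=> p _; rewrite inE; case: (e _ _).
rewrite -(pair_bigA _ (fun x y => (e x y : nat))); apply: eq_bigr => x _ /=.
by rewrite /outdeg -sum1_card big_mkcond; apply: eq_bigr => y _; rewrite inE; case: (e _ _).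
Qed.

(** With [z = 2^L], the number of events times [n^2] is at most [z^7], while
    [exp (- 8 L) <= z^-8]. *)
Lemma events_le (n L : nat) : (n < 2 ^ L)%N -> (0 < L)%N -> (0 < n)%N ->
  (4 * n * (L.+1 * 2))%N%:R * exp (- (8%:R * L%:R)) <= 1 / n%:R ^+ 2.
Proof.
move=> nL L0 n0.
have e2 : exp (- (8%:R * L%:R)) <= 2 ^- (8 * L).
  have -> : - (8%:R * L%:R) = (-1) *+ (8 * L)%N :> Defs.R.
    by rewrite mulrnAl -[RHS]mulr_natl natrM; ring.
  rewrite -expRX -exprVn lerXn2r ?nnegrE ?invr_ge0 ?(ltW (exp_gt0 _))//.
  have h1 : exp 1 * exp (-1) = 1 by rewrite -expD subrr; exact: exp_0.
  have := ler_wpM2r (ltW (exp_gt0 (-1))) (exp_ge1D 1); rewrite h1; lra.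
rewrite ler_pdivlMr ?exprn_gt0 ?ltr0n//.
apply: (@le_trans _ _ ((4 * n * (L.+1 * 2))%N%:R * 2 ^- (8 * L) * n%:R ^+ 2)).
  by rewrite ler_wpM2r ?exprn_ge0// ler_wpM2l.
rewrite mulrAC ler_pdivrMr ?exprn_gt0// mul1r -!natrX -natrM ler_nat.
have Ll : (L.+1 <= 2 ^ L)%N by apply: ltn_expl.
have L2 : (2 <= 2 ^ L)%N by rewrite -{1}[2%N]expn1 leq_exp2l.
rewrite [(8 * L)%N]mulnC expnM.
move: (2 ^ L)%N nL Ll L2 => z /ltnW nz Lz z2.
have -> : (z ^ 8 = z * z * z * (z * z) * z ^ 2 * z)%N by rewrite !expnS !muln1 !mulnA.
apply: leq_trans (leq_pmulr _ (ltnW z2)); rewrite leq_mul ?leq_exp2r//.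
by rewrite leq_mul// leq_mul// (leq_mul z2 z2).
Qed.

Theorem theorem4 :
  exists K : R,
  forall DARV : R, 1 <= DARV ->
  forall beta : R, 1 < beta ->
  forall (n : nat) (Dn : R), R_sqrt.sqrt (Rpower.ln n%:R) < Dn ->
  forall d : R, DARV * Dn * (log2 n%:R) ^+ 2 <= d ->
  forall (VG VH : finType) (LG RG : {set VG}) (LH RH : {set VH})
         (eG : rel VG) (eH : rel VH),
  is_graph eG -> is_graph eH ->
  LG :|: RG = [set: VG] -> LG :&: RG = set0 ->
  LH :|: RH = [set: VH] -> LH :&: RH = set0 ->
  (#|LG|)%:R = n%:R / 2%:R :> R -> (#|RG|)%:R = n%:R / 2%:R :> R ->
  (#|LH|)%:R = n%:R / 2%:R :> R -> (#|RH|)%:R = n%:R / 2%:R :> R ->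
  nedges eH <= d * n%:R / 2%:R ->
  1 - 1 / (n%:R ^+ 2) <=
  prob_unif (PiLR LH RH LG RG)
    (fun pi : {ffun VH -> VG} =>
       forall phi : VG -> 'I_n -> R, feasible_sdp phi ->
       forall t : nat, (t%:Z <= Num.ceil (log2 DARV))%R ->
       (#|Sset eG eH pi phi beta d Dn (2%:R ^- t)|)%:R
         <= K * (2%:R ^- t) * d * n%:R).
Proof.
have [T0 [cl [T00 sk]]] := sketch_exists.
set c0 : Defs.R := ln #|T0|%:R.
have c00 : 0 <= c0.
  have -> : 0 = ln 1 :> Defs.R by rewrite [RHS]ln_1.
  by apply: ler_ln; rewrite ?ltr01 ?ler1n.
pose K1 : Defs.R := (512%:R + 288%:R * c0)%R.
(* [10 = 2 * 5]: sampling keeps half of the pairs, and the class bounds sum to [5 d n]. *)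
exists ((10%:R * K1)%R : Defs.R) => DARV DARV1 beta beta1 n Dn hDn d hd VG VH LG RG LH RH eG eH.
move=> _ _ UG IG UH IH cLG cRG cLH cRH hE.
have half_card (V : finType) (A : {set V}) : #|A|%:R = n%:R / 2%:R :> Defs.R ->
    #|A| = n./2 /\ ~~ odd n.
  move=> h; have : (#|A| * 2)%N%:R = n%:R :> Defs.R by rewrite natrM h divfK ?pnatr_eq0.
  by move=> /eqP; rewrite eqr_nat => /eqP <-; rewrite muln2 doubleK odd_double.
have [{}cLG n_even] := half_card _ _ cLG; have [{}cRG _] := half_card _ _ cRG.
have [{}cLH _] := half_card _ _ cLH; have [{}cRH _] := half_card _ _ cRH.
have n2N : n = (n./2 + n./2)%N by rewrite addnn halfK (negPf n_even) subn0.
have nVG : #|VG| = n by rewrite -cardsT -UG cardsU IG cards0 subn0 cLG cRG.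
have nVH : #|VH| = n by rewrite -cardsT -UH cardsU IH cards0 subn0 cLH cRH.
set Pi := PiLR LH RH LG RG.
have Pi0 : (0 < #|Pi|)%N.
  by apply: (PiLR_neq0 UH IH UG IG); rewrite ?cLH ?cRH ?cLG ?cRG.
have Pi_inj : {in Pi, forall pi : {ffun VH -> VG}, injective pi}.
  by move=> pi; rewrite inE => /andP[/injectiveP].
apply: prob_unif_ge => //; set Bad := [set pi in Pi | _].
have Dn0 : 0 < Dn by apply: le_lt_trans hDn; rewrite RsqrtE sqrtr_ge0.
have d_ge0 : 0 <= d.
  apply: le_trans hd; apply: mulr_ge0 (sqr_ge0 _); apply: mulr_ge0 (ltW Dn0); lra.
have K1_ge0 : 0 <= K1 by rewrite /K1; lra.
have Bad_set0 : (forall pi (phi : VG -> 'I_n -> Defs.R) t,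
    pi \in Pi -> Sset eG eH pi phi beta d Dn (2%:R ^- t) = set0 :> {set VG * VG}) ->
    #|Bad|%:R <= #|Pi|%:R * (1 / n%:R ^+ 2) :> Defs.R.
  move=> Sset0; have -> : Bad = set0; last first.
    by rewrite cards0 mulr_ge0// divr_ge0// exprn_ge0.
  apply/setP => pi; rewrite [RHS]inE; apply/negbTE.
  rewrite inE; apply/negP => /andP[piPi /negP]; apply; apply/asboolP => phi _ t _.
  by rewrite (Sset0 _ _ _ piPi) cards0 !mulr_ge0 ?invr_ge0 ?exprn_ge0.
have [n0|n_gt0] := posnP n.
  apply: Bad_set0 => pi phi t _; apply/eqP; rewrite -cards_eq0 -leqn0.
  by apply: leq_trans (max_card _) _; rewrite card_prod nVG n0.
have n1 : (1 < n)%N by move: n_gt0 n_even; case: (n) => [|[|]].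
have N0 : (0 < n./2)%N by rewrite half_gt0.
have [L [nL L0 L1 Llog log1]] := exists_log2_bound n1.
have LR : 0 < L%:R :> Defs.R by rewrite ltr0n.
have nR : 0 < n%:R :> Defs.R by rewrite ltr0n.
have Dn12 : 1 / 2%:R <= Dn.
  have ln_n : (1 / 2%:R) ^+ 2 <= ln n%:R.
    have : ln 2%:R <= ln n%:R by apply: ler_ln; rewrite ?ltr0n// ler_nat.
    have := ln2_ge; lra.
  apply/ltW/(le_lt_trans _ hDn); rewrite RsqrtE -[leLHS]ger0_norm ?divr_ge0//.
  by rewrite -sqrtr_sqr ler_wsqrtr.
have log_sq : 1 <= log2 n%:R ^+ 2 by rewrite exprn_ege1.
have d12 : 1 / 2%:R <= d.
  apply: le_trans hd; have h1 : 1 / 2%:R <= DARV * Dn.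
    by have := ler_wpM2r (ltW Dn0) DARV1; lra.
  have h2 : 0 <= DARV * Dn by lra.
  by have := ler_wpM2l h2 log_sq; lra.
have d0 : 0 < d by lra.
(* If [d > n], condition (3) asks for more than [n] neighbours. *)
have [dn|nd] := leP d n%:R; last first.
  apply: Bad_set0 => pi phi t _; apply/setP => p; rewrite [RHS]inE; apply/negP.
  rewrite inE => /and4P[_ _ _]; rewrite ge_max => /andP[h _].
  have : (short phi (delta / 2%:R) p.1 eG)%:R <= n%:R :> Defs.R.
    by rewrite ler_nat (leq_trans (max_card _))// nVG.
  have : 1 * d <= beta * d by rewrite ler_wpM2r// ltW.
  lra.
have [B halfB] := exists_half_set IH cLH cRH.
have degn x : (outdeg eH x <= n)%N by rewrite -nVH max_card.
have [kc kcP] := @exists_degree_class VH (outdeg eH) L d d12 (fun x => leq_ltn_trans (degn x) nL).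
(* Each piece is one degree class within one half of [VH]. *)
pose X (kb : 'I_L.+1 * bool) := [set x | (kc x, x \in B) == kb].
pose lam (t : nat) kb : Defs.R := (K1 * (2 ^- t *
  (\sum_(x in X kb) (outdeg eH x)%:R + d * n%:R / L%:R)))%R.
pose Bd (i : 'I_(4 * n) * ('I_L.+1 * bool)) := [set pi in Pi |
  `[< exists2 phi : VG -> 'I_n -> Defs.R, feasible_sdp phi &
      2%:R * lam i.1 i.2 < #|Sclass eG eH beta d Dn (2 ^- i.1) pi phi (X i.2)|%:R >]].
pose okt (t : nat) := (t%:Z <= Num.ceil (log2 DARV))%R.
(* The lower bound on [d] enters here, with [2^t < 2 DARV] and [L <= 2 log2 n]. *)
have eta_d t : okt t -> Dn * L%:R ^+ 2 <= 8%:R * (2 ^- t * d).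
  move=> /(expr2_lt_of_ceil_log2 DARV1) h.
  have p2 : 0 < 2 ^+ t :> Defs.R by rewrite exprn_gt0.
  rewrite [leRHS]mulrCA [leRHS]mulrC ler_pdivlMr//.
  have hL : L%:R ^+ 2 <= 4%:R * log2 n%:R ^+ 2.
    have -> : 4%:R * log2 n%:R ^+ 2 = (2%:R * log2 n%:R) ^+ 2 :> Defs.R.
      by move: (log2 _) => q; ring.
    by rewrite lerXn2r ?nnegrE// mulr_ge0//; lra.
  apply: (@le_trans _ _ (Dn * (4%:R * log2 n%:R ^+ 2) * (2%:R * DARV))).
    apply: ler_pM => //; [|exact: ltW| |exact: ltW].
      by rewrite mulr_ge0 ?sqr_ge0 ?(ltW Dn0).
    by rewrite ler_wpM2l// ltW.
  by move: hd; set q := log2 _ ^+ 2; lra.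
(* [2^t < 2 DARV <= 4 d <= 4 n], so finitely many scales, bounded in terms of [n], enter the union
   bound. *)
have t4n t : okt t -> (t < 4 * n)%N.
  move=> /(expr2_lt_of_ceil_log2 DARV1) h.
  apply: leq_trans (ltn_expl t (isT : (1 < 2)%N)) _; apply: ltnW.
  rewrite -(ltr_nat Defs.R) natrX natrM; apply: lt_le_trans h _.
  have h1 : DARV * (1 / 2%:R) * 1 <= DARV * Dn * log2 n%:R ^+ 2.
    have D0 : 0 <= DARV by lra.
    by apply: ler_pM => //; rewrite ?ler_wpM2l// mulr_ge0// divr_ge0.
  lra.
have Bad_sub : Bad \subset \bigcup_(i : 'I_(4 * n) * ('I_L.+1 * bool) | okt i.1) Bd i.
  apply/subsetP => pi; rewrite inE => /andP[piPi]; apply: contraNT => nin.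
  apply/asboolP => phi fphi t tT; set S := Sset _ _ _ _ _ _ _ _.
  have small kb : #|Sclass eG eH beta d Dn (2 ^- t) pi phi (X kb)|%:R <= 2%:R * lam t kb.
    rewrite leNgt; apply: contra nin => big; apply/bigcupP.
    exists (Ordinal (t4n _ tT), kb) => //; rewrite inE piPi; apply/asboolP.
    by exists phi.
  have cover : S \subset \bigcup_kb Sclass eG eH beta d Dn (2 ^- t) pi phi (X kb).
    apply/subsetP => p pS; have := pS; rewrite inE => /and4P[].
    move=> /existsP[x /existsP[y /and3P[_ /eqP xp _]]] _ _ _.
    apply/bigcupP; exists (kc x, x \in B) => //; rewrite inE pS /= -xp.
    by apply/imsetP; exists x => //; rewrite inE.
  have sumE : \sum_kb \sum_(x in X kb) (outdeg eH x)%:R <= d * n%:R.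
    have -> : \sum_kb \sum_(x in X kb) (outdeg eH x)%:R = \sum_x (outdeg eH x)%:R :> Defs.R.
      rewrite [RHS](partition_big (fun x => (kc x, x \in B)) xpredT)//=.
      by apply: eq_bigr => kb _; apply: eq_bigl => x; rewrite inE.
    by rewrite sum_outdeg; move: hE; lra.
  apply: (@le_trans _ _ (\sum_kb 2%:R * lam t kb)).
    apply: (@le_trans _ _ (\sum_kb #|Sclass eG eH beta d Dn (2 ^- t) pi phi (X kb)|%:R)).
      rewrite -natr_sum ler_nat; apply: leq_trans (card_bigcup_le _ _).
      exact: subset_leq_card.
    exact: ler_sum.
  rewrite -mulr_sumr -!mulr_sumr big_split /= sumr_const card_prod card_ord card_bool.
  rewrite -[_ *+ (_ * _)]mulr_natl natrM.
  have p0 : 0 <= K1 * 2 ^- t by rewrite mulr_ge0// invr_ge0 exprn_ge0.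
  have dnL : L.+1%:R * (d * n%:R / L%:R) <= 2%:R * (d * n%:R).
    have -> : 2%:R * (d * n%:R) = 2%:R * L%:R * (d * n%:R / L%:R).
      by field; rewrite gt_eqF.
    by rewrite ler_wpM2r// divr_ge0 ?mulr_ge0// ltW.
  (* The degrees contribute at most [d n], and the [2 (L+1)] pieces add [d n / L] each, at most
     [4 d n] together. *)
  have le5 : \sum_kb \sum_(x in X kb) (outdeg eH x)%:R +
      L.+1%:R * 2%:R * (d * n%:R / L%:R) <= 5%:R * (d * n%:R) by lra.
  have := ler_wpM2l p0 le5; lra.
have Bd_le (i : 'I_(4 * n) * ('I_L.+1 * bool)) : okt i.1 ->
    #|Bd i|%:R <= #|Pi|%:R * exp (- (8%:R * L%:R)).
  case: i => t [k b] /= ti.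
  have p0 : 0 < 2 ^+ k :> Defs.R by rewrite exprn_gt0.
  have XP x : x \in X (k, b) -> kc x = k /\ (x \in B) = b.
    by rewrite inE => /eqP[].
  have Xhalf (A : {set VH}) : (2 * #|(if b then B else ~: B) :&: A| <= (n./2).+1)%N ->
      (2 * #|X (k, b) :&: A| <= (n./2).+1)%N.
    apply: leq_trans; rewrite leq_mul2l /=; apply/subset_leq_card/setSI/subsetP => x /XP[_ <-].
    by case: (boolP (x \in B)) => // xB; rewrite inE.
  have sp : spread Pi (X (k, b)) (4%:R / n%:R).
    have -> : 4%:R / n%:R = 2%:R / (n./2)%:R :> Defs.R.
      rewrite [in LHS]n2N natrD; field.
      by rewrite -natrD -n2N !pnatr_eq0 -!lt0n N0.
    have [h1 h2] := halfB b.
    by apply: PiLR_spread => //; exact: Xhalf.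
  have XD x : x \in X (k, b) -> (outdeg eH x)%:R <= 2 ^+ k.+1 * d.
    by move=> /XP[<- _]; apply: ltW; have [] := kcP x.
  apply: (@class_tail _ _ _ cl eG eH n L beta d Dn (2 ^- t) (2 ^+ k.+1 * d) Pi (X (k, b))
    sk T00 nVH nVG n_gt0 nL L0 d0 beta1 Dn12 _ (eta_d _ ti) Pi_inj sp) => //.
  - by rewrite invr_gt0 exprn_gt0.
  - by rewrite mulr_gt0// exprn_gt0.
  (* In class 0, [D = 2 d <= 2 n]; otherwise [D] is at most twice the degree of a member. *)
  - move=> /set0Pn[x /XP[xk _]]; have [_] := kcP x; rewrite xk => -[->|h].
      by rewrite expr1; lra.
    have : (outdeg eH x)%:R <= n%:R :> Defs.R by rewrite ler_nat.
    rewrite exprS; lra.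
  (* In class 0, [2 d / (4 Dn) <= d <= beta d] because [Dn >= 1/2]; in the others [D] is at most
     twice the degree of [x]. *)
  - move=> x /XP[xk _]; rewrite le_max; have [_] := kcP x; rewrite xk => -[->|h].
      apply/orP; left; rewrite expr1 ler_pdivrMr ?mulr_gt0//.
      have h1 : d * 1 <= d * beta by rewrite ler_wpM2l// ltW.
      have h2 : 0 <= beta * d by lra.
      have := ler_wpM2l h2 Dn12; lra.
    apply/orP; right; rewrite ler_pdivrMr ?mulr_gt0//.
    have -> : (outdeg eH x)%:R / Dn * (4%:R * Dn) = 4%:R * (outdeg eH x)%:R.
      by field; rewrite gt_eqF.
    by rewrite exprS; have : 0 <= (outdeg eH x)%:R :> Defs.R by []; lra.
apply: (@le_trans _ _ (\sum_(i : 'I_(4 * n) * ('I_L.+1 * bool) | okt i.1) #|Bd i|%:R)).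
  rewrite -natr_sum ler_nat; apply: leq_trans (card_bigcup_le _ _).
  exact: subset_leq_card.
apply: (@le_trans _ _ (\sum_(i : 'I_(4 * n) * ('I_L.+1 * bool)) #|Pi|%:R * exp (- (8%:R * L%:R)))).
  rewrite big_mkcond; apply: ler_sum => i _; case: ifP => [/Bd_le//|_].
  by rewrite mulr_ge0// ltW// exp_gt0.
rewrite sumr_const !card_prod !card_ord card_bool -[leLHS]mulr_natl mulrCA ler_wpM2l//.
exact: events_le.
Qed.
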